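(* Let $S=K[X,Y]$, let $I\in\mathcal F[2]$ be written as $I=\sum_{i=0}^{r}\Phi_{i+1}\cdots\Phi_{r+1}S_{\beta_i}S$, let $\Phi=\Phi_1\cdots\Phi_r$ and $\Phi_k=H_{k1}^{\mu_{k1}}\cdots H_{kv_k}^{\mu_{kv_k}}$ as in the context, and let $\mathcal B(I)=(\mathcal B^0,\mathcal B^1,\dots,\mathcal B^r)$, $\mathcal B^0=(F^0_j)$, $\mathcal B^k=(F^k_{ij})$, be the standard basis of $I$ corresponding to the canonical matrix $M(I)$ described in the context. Then: (i) All the elements of $\mathcal B^0$ are essential. The generator $F^k_{ij}\in\mathcal B^k$ is essential if and only if $j=\mu_{ki}$ and $H_{ki}$ is not a factor of it. (ii) $\mathcal B(I)$ is an e-maximal basis, and the number of its essential elements in degree bigger than $\alpha(I)$ is equal to the number $v$ of distinct linear factors (up to scalars) appearing in a factorization of $\Phi$. (iii) In any e-maximal basis of $I$, for $k=1,\dots,r$, the essential generators appearing in degree $\alpha_k$ are as many as the distinct linear factors of $\Phi_k$ that do not divide $\Phi_{k+1}\cdots\Phi_r$. (iv) $I$ admits a standard basis of essential elements if and only if $\Phi$ is a product of distinct linear factors.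
   Context: $K$ is an algebraically closed field, $S=K[X,Y]$, $\mathfrak M=(X,Y)$, $S_t$ is the set of forms of degree $t$. A standard basis of a homogeneous ideal $I$ is an ordered set of forms generating $I$ such that its elements of degree $d$ define a $K$-basis of $I_d/(I_{d-1}S_1)$ for every $d$; $\nu(I)$ is its number of elements and $\alpha(I)$ the smallest degree of its elements. $\mathcal F[2]$ is the set of homogeneous (perfect) height $2$ ideals of $S$ with $\nu(I)=\alpha(I)+1$. Representation: every $I\in\mathcal F[2]$ can be written as $I=\sum_{i=0}^{r}\Phi_{i+1}\cdots\Phi_{r+1}S_{\beta_i}S$, where $\Phi_1,\dots,\Phi_r$ are forms of positive degrees $\delta_1,\dots,\delta_r$, $\Phi_{r+1}=1$, $\beta_0\ge0$, $\beta_i=\beta_{i-1}+\delta_i+t_i$ with $t_i>0$. Put $\Delta_0=0$, $\Delta_i=\delta_1+\dots+\delta_i$, $\delta=\Delta_r$, $\alpha_i=\beta_i+\delta-\Delta_i$; the $\alpha_0<\dots<\alpha_r$ are the distinct degrees of the elements of a standard basis, $\alpha_0=\alpha(I)$. For each $k$ write $\Phi_k=H_{k1}^{\mu_{k1}}\cdots H_{kv_k}^{\mu_{kv_k}}$ with $H_{k1},\dots,H_{kv_k}$ pairwise linearly independent linear forms and $\mu_{kj}\ge1$, normalized so that any two of the $H_{kj}$ (also for different $k$) are either equal or linearly independent (multiplying $\Phi_k$ by nonzero constants does not change $I$). Choose linear forms $U,L_0,\dots,L_{\beta_0}$, pairwise linearly independent and linearly independent from each $H_{kj}$. The canonical matrix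 is the $(\beta_0+\delta)\times(\beta_0+\delta+1)$ matrix $M(I)=\begin{pmatrix}\mathcal B&0\\ \mathcal C&\mathcal A\end{pmatrix}$ where: $\mathcal B=(b_{ij})$ is $\beta_0\times(\beta_0+1)$ with $b_{ii}=L_{i-1}$, $b_{i(i+1)}=-L_i$, zero otherwise; $\mathcal C$ is $\delta\times(\beta_0+1)$ with only nonzero entry $c_{1(\beta_0+1)}=L_{\beta_0}U^{t_1}$; $\mathcal A=(a_{ij})$ is $\delta\times\delta$ with $a_{ij}=0$ for $j\ne i,i-1$, diagonal $(a_{11},\dots,a_{\delta\delta})$ equal to the sequence of the $-H_{ki}$, each repeated $\mu_{ki}$ times, with $(k,i)$ in lexicographic order, and for $1\le i\le\delta-1$: if $a_{ii}\ne a_{jj}$ for all $j>i$, then $a_{(i+1)i}=-a_{ii}$ when $i\notin\{\Delta_1,\dots,\Delta_{r-1}\}$ and $a_{(i+1)i}=-a_{ii}U^{t_{k+1}}$ when $i=\Delta_k$, $k<r$; if $a_{ii}=a_{jj}$ for some $j>i$, then $a_{(i+1)i}=-U$ when $i\notin\{\Delta_1,\dots,\Delta_{r-1}\}$ and $a_{(i+1)i}=U^{t_{k+1}+1}$ when $i=\Delta_k$, $k<r$. It is a Hilbert-Burch matrix of $I$; the corresponding standard basis consists of the maximal minors (with signs), the element attached to a column being obtained by deleting that column. The elements attached to the first $\beta_0+1$ columns are $F^0_0,\dots,F^0_{\beta_0}$ (these form $\mathcal B^0$), and those attached to the last $\delta$ columns are the $F^k_{ij}$, $k=1,\dots,r$,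 $i=1,\dots,v_k$, $j=1,\dots,\mu_{ki}$, with $(k,i,j)$ in lexicographic order; for fixed $k$ they form $\mathcal B^k$ and have degree $\alpha_k$. Given a standard basis $\mathcal B$ of $I$, $f\in\mathcal B$ is inessential with respect to $\mathcal B$ if there is $t\in\mathbb N$ with $f\,\mathfrak M^t\subseteq(\mathcal B\setminus\{f\})S$; otherwise it is essential. A standard basis is e-maximal if for every $d$ it has exactly $\nu_e(d)$ essential elements of degree $d$, where $\nu_e(d)$ is the greatest number of essential elements of degree $d$ appearing in a standard basis of $I$. *)

(* Defs.v *)
From HB Require Import structures.
From mathcomp Require Import all_boot all_order all_algebra.
From mathcomp Require Import mpoly.
From mathcomp Require Import boolp classical_sets.

Set Implicit Arguments.
Unset Strict Implicit.
Unset Printing Implicit Defensive.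

Import GRing.Theory.
Local Open Scope ring_scope.
Local Open Scope classical_set_scope.

Section BivariateIdeals.
Context {K : closedFieldType}.
Local Notation S := {mpoly K[2]}.
Implicit Types (I J P A : set S) (f g l : S) (B : seq S).

Definition ideal I : Prop :=
  [/\ I 0, (forall f g, I f -> I g -> I (f + g))
    & (forall f g, I g -> I (f * g))].

Definition generated A : set S :=
  [set f | exists2 s : seq (S * S), (forall p, p \in s -> A p.2)
                                  & f = \sum_(p <- s) p.1 * p.2].

Definition maxideal : set S := generated [set f | exists i : 'I_2, f = 'X_i].

Fixpoint ideal_exp I (t : nat) : set S :=
  if t is t'.+1
  then generated [set h | exists f g, [/\ I f, ideal_exp I t' g & h = f * g]]
  else setT.

Definition homogeneous_ideal I : Prop :=
  ideal I /\ forall f d, I f -> I (pihomog mdeg d f).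

Definition prime_ideal P : Prop :=
  [/\ ideal P, ~ P 1 & forall f g, P (f * g) -> P f \/ P g].

Definition height_geq (n : nat) I : Prop :=
  forall P, prime_ideal P -> I `<=` P ->
  exists C : nat -> set S,
    [/\ forall i, (i <= n)%N -> prime_ideal (C i),
        forall i, (i < n)%N -> C i `<=` C i.+1 /\ C i <> C i.+1
      & C n = P].

(* The unit ideal lies in no prime, hence has infinite height. *)
Definition has_height I (n : nat) : Prop :=
  height_geq n I /\ ~ height_geq n.+1 I.

Definition form_deg f : nat := (msize f).-1.

(* I_(d-1) S_1, which is 0 for d = 0. *)
Definition prev_degree_part I (d : nat) : set S :=
  [set f | exists2 s : seq (S * S),
    (forall p, p \in s ->
       [/\ I p.1, (exists2 e, e.+1 = d & p.1 \is e.-homog)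
         & p.2 \is 1.-homog])
    & f = \sum_(p <- s) p.1 * p.2].

(* Freeness forces the members of a standard basis to be nonzero and pairwise
   distinct. *)
Definition basis_in_degree I (d : nat) (Bd : seq S) : Prop :=
  (forall f, I f -> f \is d.-homog -> exists c : 'I_(size Bd) -> K,
     prev_degree_part I d (f - \sum_i c i *: Bd`_i)) /\
  (forall c : 'I_(size Bd) -> K,
     prev_degree_part I d (\sum_i c i *: Bd`_i) -> forall i, c i = 0).

Definition standard_basis I B : Prop :=
  [/\ (forall f, f \in B -> exists d, f \is d.-homog),
      I = generated [set f | f \in B]
    & forall d, basis_in_degree I d [seq f <- B | f \is d.-homog]].

Definition is_nu I (n : nat) : Prop :=
  exists2 B, standard_basis I B & size B = n.

Definition is_alpha I (a : nat) : Prop :=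
  exists2 B, standard_basis I B &
    (exists2 f, f \in B & form_deg f = a) /\
    (forall f, f \in B -> (a <= form_deg f)%N).

Definition in_F2 I : Prop :=
  [/\ homogeneous_ideal I, has_height I 2
    & exists2 a, is_alpha I a & is_nu I a.+1].

Definition inessential B f : Prop :=
  exists t : nat, forall g, ideal_exp maxideal t g ->
    generated [set h | h \in [seq h <- B | h != f]] (f * g).

Definition essential B f : Prop := ~ inessential B f.

Definition nb_essential B (d : nat) : nat :=
  count (fun f => `[< essential B f >] && (form_deg f == d)) B.

Definition nb_essential_above B (a : nat) : nat :=
  count (fun f => `[< essential B f >] && (a < form_deg f)%N) B.

Definition is_nu_e I (d n : nat) : Prop :=
  (exists2 B, standard_basis I B & nb_essential B d = n) /\
  (forall B, standard_basis I B -> (nb_essential B d <= n)%N).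

Definition e_maximal I B : Prop :=
  standard_basis I B /\ forall d, is_nu_e I d (nb_essential B d).

Definition linear_form l : Prop := l \is 1.-homog /\ l != 0.

Definition lin_indep f g : Prop :=
  forall a b : K, a *: f + b *: g = 0 -> a = 0 /\ b = 0.

Definition divides f g : Prop := exists q, g = q * f.

Definition linear_forms_pairwise_indep (s : seq S) : Prop :=
  (forall l, l \in s -> linear_form l) /\
  (forall i j, (i < j < size s)%N -> lin_indep s`_i s`_j).

(* There are exactly n linear forms, counted up to scalars, satisfying Q. *)
Definition nb_linear_forms (Q : S -> Prop) (n : nat) : Prop :=
  exists s : seq S,
    [/\ size s = n, linear_forms_pairwise_indep s
      & forall l, linear_form l ->
          (Q l <-> exists2 g, g \in s & exists c : K, l = c *: g)].

Definition product_of_distinct_linear_factors f : Prop :=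
  exists2 s : seq S, linear_forms_pairwise_indep s & f = \prod_(l <- s) l.

End BivariateIdeals.

(* The integers r, beta_0, t_k and the factorizations
   Phi_k = H_k1 ^ mu_k1 ... H_kv_k ^ mu_kv_k, indexed from 1 as k = 1, ..., r;
   values at other indices are irrelevant. *)
Record representation (K : closedFieldType) := Representation {
  rank : nat;
  beta0 : nat;
  t_ : nat -> nat;
  v_ : nat -> nat;
  mu_ : nat -> nat -> nat;
  H_ : nat -> nat -> {mpoly K[2]};
  t_gt0 : forall k, (1 <= k <= rank)%N -> (0 < t_ k)%N;
  v_gt0 : forall k, (1 <= k <= rank)%N -> (0 < v_ k)%N;
  mu_gt0 : forall k i, (1 <= k <= rank)%N -> (1 <= i <= v_ k)%N ->
    (0 < mu_ k i)%N;
  H_linear : forall k i, (1 <= k <= rank)%N -> (1 <= i <= v_ k)%N ->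
    linear_form (H_ k i);
  H_indep : forall k i j, (1 <= k <= rank)%N -> (1 <= i < j)%N ->
    (j <= v_ k)%N -> lin_indep (H_ k i) (H_ k j);
  H_normalized : forall k i m j,
    (1 <= k <= rank)%N -> (1 <= i <= v_ k)%N ->
    (1 <= m <= rank)%N -> (1 <= j <= v_ m)%N ->
    H_ k i = H_ m j \/ lin_indep (H_ k i) (H_ m j)
}.

Section CanonicalMatrix.
Context {K : closedFieldType}.
Variable D : representation K.
Local Notation S := {mpoly K[2]}.
Local Notation r := (rank D).

Definition Phi (k : nat) : S := \prod_(1 <= i < (v_ D k).+1) H_ D k i ^+ mu_ D k i.

(* Phi_(i+1) ... Phi_r; the factor Phi_(r+1) = 1 is omitted. *)
Definition PhiTail (i : nat) : S := \prod_(i.+1 <= k < r.+1) Phi k.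

Definition PhiAll : S := PhiTail 0.

Definition delta (k : nat) : nat := (\sum_(1 <= i < (v_ D k).+1) mu_ D k i)%N.

Definition Delta (i : nat) : nat := (\sum_(1 <= k < i.+1) delta k)%N.

Definition beta (i : nat) : nat :=
  (beta0 D + \sum_(1 <= k < i.+1) (delta k + t_ D k))%N.

Definition alpha (i : nat) : nat := (beta i + (Delta r - Delta i))%N.

Definition represented_ideal : set S :=
  generated [set f | exists i g,
    [/\ (i <= r)%N, g \is (beta i).-homog & f = PhiTail i * g]].

(* The triples ((k, i), j), 1 <= j <= mu_ki, in lexicographic order. *)
Definition labels : seq (nat * nat * nat) :=
  [seq (p, j) | p <- [seq (k, i) | k <- iota 1 r, i <- iota 1 (v_ D k)],
                j <- iota 1 (mu_ D p.1 p.2)].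

Definition Adiag : seq S := [seq - H_ D p.1.1 p.1.2 | p <- labels].

(* Some k if i = Delta_k with 1 <= k < r. *)
Definition block_end (i : nat) : option nat :=
  ohead [seq k <- iota 1 r.-1 | Delta k == i].

Definition admissible (U : S) (L : nat -> S) : Prop :=
  [/\ linear_form U /\ (forall j, (j <= beta0 D)%N -> linear_form (L j)),
      forall j, (j <= beta0 D)%N -> lin_indep U (L j),
      forall i j, (i < j <= beta0 D)%N -> lin_indep (L i) (L j)
    & forall k i, (1 <= k <= r)%N -> (1 <= i <= v_ D k)%N ->
        lin_indep U (H_ D k i) /\
        forall j, (j <= beta0 D)%N -> lin_indep (L j) (H_ D k i)].

Variables (U : S) (L : nat -> S).

(* Matrix indices start at 0, so that column j of A carries the entries
   a_(j+1)(j+1) and a_(j+2)(j+1) of the 1-based description. *)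
Definition Asubdiag (j : nat) : S :=
  let a := Adiag`_j in
  match block_end j.+1, a \in drop j.+1 Adiag with
  | None, false => - a
  | Some k, false => - a * U ^+ t_ D k.+1
  | None, true => - U
  | Some k, true => U ^+ (t_ D k.+1).+1
  end.

Definition Bblock : 'M[S]_(beta0 D, (beta0 D).+1) :=
  \matrix_(i, j) if j == i :> nat then L i
                 else if j == i.+1 :> nat then - L i.+1 else 0.

Definition Cblock : 'M[S]_(Delta r, (beta0 D).+1) :=
  \matrix_(i, j) if (i == 0%N :> nat) && (j == beta0 D :> nat)
                 then L (beta0 D) * U ^+ t_ D 1 else 0.

Definition Ablock : 'M[S]_(Delta r) :=
  \matrix_(i, j) if i == j then Adiag`_i
                 else if i == j.+1 :> nat then Asubdiag j else 0.

Definition canonical_matrix : 'M[S]_(beta0 D + Delta r, (beta0 D + Delta r).+1) :=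
  block_mx Bblock 0 Cblock Ablock.

Definition canonical_basis : seq S :=
  [seq (-1) ^+ j * \det (col' j canonical_matrix)
     | j : 'I_(beta0 D + Delta r).+1 <- enum 'I_(beta0 D + Delta r).+1].

Definition F0 (j : nat) : S := canonical_basis`_j.

Definition Fk (k i j : nat) : S :=
  canonical_basis`_((beta0 D).+1 + index (k, i, j) labels).

End CanonicalMatrix.

(* Main.v *)
Require Import Defs.
From mathcomp Require Import all_boot all_order all_algebra.
From mathcomp Require Import mpoly ring zify.
From mathcomp Require Import boolp classical_sets.
Set Implicit Arguments.
Unset Strict Implicit.
Unset Printing Implicit Defensive.
Import GRing.Theory.
Local Open Scope ring_scope.

(** The canonical matrix is upper bidiagonal, so its maximal minors are products:
    the j-th one is, up to sign, the product of the diagonal entries above row j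
    and of the superdiagonal entries from row j on. The superdiagonal entries
    are, up to sign, the linear forms L_1, ..., L_beta0 followed by the factors
    H_ki of Phi with multiplicity; the diagonal entries are products of linear
    forms, and no diagonal entry vanishes at the zero of a superdiagonal entry in
    its row or below. These facts are isolated in the structure [chain].

    Everything is then decided by evaluating forms at points of the projective
    line. A form vanishing at the zero of a linear form l is a multiple of l
    ([form_vanish_dvd]). Dividing by the superdiagonal entries one after the other
    shows that the ideal of the minors has, in each degree, the form
    (product of the last superdiagonal entries) * (all forms), which identifies it
    with the represented ideal ([represented_idealE]) and makes the minors a
    standard basis ([minors_standard_basis]).

    Forms in K[X, Y] without a common zero generate an ideal containing a power
    of the maximal ideal ([maxideal_exp_sub]). As I has no zero, an element f of a
    standard basis is therefore essential exactly when some point is a zero of all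
    the other elements but not of f ([essentialP]). Let f, of degree above
    alpha(I), be essential in an arbitrary standard basis. The point in question is
    a zero of the first minor, hence of some superdiagonal entry. The minor
    following the last occurrence of this linear form on the superdiagonal is the
    only minor not vanishing at the point, so that f has the degree of this minor
    ([essential_detected]). Thus in each degree above alpha(I) there are at most as
    many essential elements as last occurrences, and the canonical basis reaches
    this bound; in degree alpha(I) all its elements are essential
    ([minors_e_maximal]). Last occurrences in block k are the factors of Phi_k that
    do not divide Phi_(k+1) ... Phi_r ([nb_factors_block]). Finally, the number of
    elements of each degree is the same in all standard bases, so a standard basis
    of essential elements forces every occurrence to be the last one, that is,
    Phi to be square-free ([last_of_all_essential], [distinct_factorsE]). *)

(** * Forms in two variables and their zeros *)

Section BinaryForms.
Context {K : closedFieldType}.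
Local Notation S := {mpoly K[2]}.
Implicit Types (f g h l q : S) (P : 'I_2 -> K).

Lemma pihomogM_homog d e f g : g \is e.-homog ->
  pihomog mdeg d (f * g) = if (e <= d)%N then pihomog mdeg (d - e) f * g else 0.
Proof.
move=> hg; rewrite {1}[f]mpolyE mulr_suml linear_sum /=.
transitivity (\sum_(m <- msupp f) if mdeg m + e == d
    then f@_m *: ('X_[m] * g) else 0).
  apply: eq_bigr => m _; rewrite -scalerAl linearZ /=.
  have hX : 'X_[m] * g \is (mdeg m + e).-homog.
    by apply: dhomogM => //; rewrite dhomogX.
  case: eqP => [<-|/eqP ne]; first by rewrite pihomog_dE.
  by rewrite (pihomog_ne0 ne hX) scaler0.
case: ifP => [le_ed|]; last first.
  move/negbT; rewrite -ltnNge => lt_de; apply: big1 => m _.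
  by case: eqP lt_de => // <-; rewrite ltnNge leq_addl.
rewrite pihomogE mulr_suml [in RHS]big_mkcond /=; apply: eq_bigr => m _.
rewrite -(eqn_add2r e (mdeg m)) subnK //.
by case: ifP; rewrite ?mul0r // scalerAl.
Qed.

Lemma dhomog0_const f : f \is 0.-homog -> f = (f@_0)%:MP.
Proof.
move=> hf; apply: msize1_polyC; rewrite msizeE.
by apply/bigmax_leqP_seq => m /(dhomog_mf hf) ->.
Qed.

Lemma form_degE d f : f != 0 -> f \is d.-homog -> form_deg f = d.
Proof. by move=> f0 hf; apply: (dhomog_uniq f0 (dhomog_msize hf) hf). Qed.

(** The zero of a linear form on the projective line, as a pair of
    homogeneous coordinates. *)
Definition root_pt l : 'I_2 -> K :=
  fun i => if i == 0 then l@_U_(1) else - l@_U_(0).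

Lemma linear_formE l : l \is 1.-homog ->
  l = l@_U_(0) *: 'X_0 + l@_U_(1) *: 'X_1.
Proof.
move=> hl; apply/mpolyP => m; rewrite mcoeffD !mcoeffZ !mcoeffX.
have [m1|m1] := eqVneq (mdeg m) 1%N; last first.
  rewrite (dhomog_nemf_coeff hl m1).
  have neU i : (U_(i) == m)%MM = false.
    by apply: contra_neqF m1 => /eqP <-; rewrite mdeg1.
  by rewrite !neU !mulr0 addr0.
have /mdeg1P [i /eqP ->] : mdeg m == 1%N by rewrite m1.
have U01 : (U_(0%R) == U_(1%R) :> 'X_{1..2})%MM = false.
  by apply/eqP => /mnmP /(_ (0 : 'I_2)); rewrite !mnm1E.
case: (unliftP (0 : 'I_2) i) => [j|] ->; last first.
  by rewrite eqxx eq_sym U01 mulr1 mulr0 addr0.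
have -> : lift 0 j = 1 by apply: val_inj; rewrite /= ord1.
by rewrite eqxx U01 mulr1 mulr0 add0r.
Qed.

Lemma meval_linear l P : l \is 1.-homog ->
  l.@[P] = l@_U_(0) * P 0 + l@_U_(1) * P 1.
Proof. by move=> hl; rewrite {1}(linear_formE hl) mevalD !mevalZ !mevalXU. Qed.

Lemma meval_root_pt l : l \is 1.-homog -> l.@[root_pt l] = 0.
Proof. by move=> hl; rewrite meval_linear // /root_pt /= mulrN mulrC subrr. Qed.

Lemma linear_form_neq0P l : l \is 1.-homog ->
  reflect (exists i, root_pt l i != 0) (l != 0).
Proof.
move=> hl; apply: (iffP idP) => [l0|[i]].
  have [r0|r0] := eqVneq (root_pt l 0) 0; last by exists 0.
  exists 1; apply: contraNneq l0 => r1; rewrite (linear_formE hl).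
  move: r0 r1; rewrite /root_pt /= => -> /eqP; rewrite oppr_eq0 => /eqP ->.
  by rewrite !scale0r addr0.
by apply: contraNneq => ->; rewrite /root_pt !mcoeff0 oppr0; case: ifP.
Qed.

(** Modulo a linear form with zero P the two variables are proportional, and if
    P_j is nonzero then P_j^d f is congruent to f(P) X_j^d for every form f of
    degree d. *)
Lemma form_vanish_dvd d f l : f \is d.+1.-homog -> linear_form l ->
  f.@[root_pt l] = 0 -> exists2 q, q \is d.-homog & f = q * l.
Proof.
move=> hf [hl /(linear_form_neq0P hl) [j Pj0]] fP0.
suff [q eq_f] : exists q, f = q * l.
  exists (pihomog mdeg d q); first exact: pihomogP.
  by rewrite -{1}(pihomog_dE hf) eq_f (pihomogM_homog _ _ hl) subn1.
set P := root_pt l in fP0 Pj0.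
(* i is the index of the other variable *)
pose i : 'I_2 := 1 - j.
have [ij El] : i != j /\ exists c, P j *: 'X_i - P i *: 'X_j = c *: l.
  rewrite /i {1}(linear_formE hl) /P /root_pt; clear.
  case: (unliftP (0 : 'I_2) j) => [k|] ->; last first.
    rewrite subr0 /=; split=> //; exists 1.
    by rewrite scale1r scaleNr opprK addrC.
  have -> : lift 0 k = 1 by apply: val_inj; rewrite /= ord1.
  rewrite subrr /=; split=> //; exists (-1).
  by rewrite scaleN1r scaleNr opprD.
case: El => c El.
have Xm (m : 'X_{1..2}) : 'X_[m] = 'X_i ^+ m i * 'X_j ^+ m j :> S.
  rewrite mpolyXE_id (bigD1 i) //= (bigD1 j) 1?eq_sym //= big1 ?mulr1 // => k.
  move: ij; case: i {El} => -[|[|//]] ?; case: j {Pj0} => -[|[|//]] ?;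
    case: k => -[|[|//]] ?; by [].
have mdegIJ (m : 'X_{1..2}) : mdeg m = (m i + m j)%N.
  rewrite mdegE (bigD1 i) //= (bigD1 j) 1?eq_sym //= big1 ?addn0 // => k.
  move: ij; case: i {El Xm} => -[|[|//]] ?; case: j {Pj0} => -[|[|//]] ?;
    case: k => -[|[|//]] ?; by [].
have key : exists q, P j ^+ d.+1 *: f - f.@[P] *: 'X_j ^+ d.+1 = q * l.
  have Ef : f.@[P] = \sum_(m <- msupp f) f@_m * (P i ^+ m i * P j ^+ m j).
    rewrite {1}[f]mpolyE linear_sum /=; apply: eq_bigr => m _.
    by rewrite mevalZ Xm rmorphM !rmorphXn /= !mevalXU.
  rewrite Ef {1}[f]mpolyE scaler_sumr scaler_suml -sumrB.
  apply: (@big_ind _ (fun x : S => exists q, x = q * l)) => [|x y [q ->] [q' ->]|].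
  - by exists 0; rewrite mul0r.
  - by exists (q + q'); rewrite mulrDl.
  - move=> m _; case: (boolP (m \in msupp f)) => [/(dhomog_mf hf)|]; last first.
      by rewrite -mcoeff_eq0 => /eqP ->; exists 0; rewrite !mul0r !scale0r scaler0 subrr.
    rewrite /= mdegIJ => Em; rewrite -Em Xm.
    have /esym := subrXX ((P j)%:MP * 'X_i) ((P i)%:MP * 'X_j : S) (m i).
    rewrite !mul_mpolyC El -!mul_mpolyC; set r := \sum_(_ < _) _ => Er.
    exists ((f@_m)%:MP * (P j)%:MP ^+ m j * 'X_j ^+ m j * (c%:MP * r)).
    transitivity ((f@_m)%:MP * (P j)%:MP ^+ m j * 'X_j ^+ m j * (c%:MP * l * r)).
      by rewrite Er !rmorphM !rmorphXn /= !exprD !exprMn; ring.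
    by ring.
case: key => q; rewrite fP0 scale0r subr0 => Eq.
exists ((P j ^+ d.+1)^-1 *: q); rewrite -scalerAl -Eq scalerA mulVf ?scale1r //.
by rewrite expf_neq0.
Qed.

Lemma divides_vanish d f l : f \is d.-homog -> linear_form l ->
  divides l f <-> f.@[root_pt l] = 0.
Proof.
move=> hf hl; split=> [[q ->]|f0].
  by rewrite mevalM meval_root_pt ?mulr0 //; case: hl.
case: d hf => [/dhomog0_const Ef|d hf].
  by move: f0; rewrite Ef mevalC => ->; exists 0; rewrite mul0r mpolyC0.
by have [q _ ->] := form_vanish_dvd hf hl f0; exists q.
Qed.

(** The value of g at the zero of f is the determinant of the coefficients of
    f and g. *)
Lemma lin_indep_vanish f g : f \is 1.-homog -> g \is 1.-homog ->
  lin_indep f g <-> g.@[root_pt f] != 0.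
Proof.
move=> hf hg; split=> [ind|g0 a b].
  apply: contraPneq ind; rewrite meval_linear // /root_pt /= => E ind.
  have E' : g@_U_(0) * f@_U_(1) = g@_U_(1) * f@_U_(0).
    by apply/eqP; rewrite -subr_eq0 -mulrN E.
  have comb a b : a *: f + b *: g = (a * f@_U_(0) + b * g@_U_(0)) *: 'X_0
      + (a * f@_U_(1) + b * g@_U_(1)) *: 'X_1.
    rewrite {1}(linear_formE hf) {1}(linear_formE hg) !scalerDr !scalerA.
    by rewrite addrACA -!scalerDl.
  have f0 : f = 0.
    have [g1 f1] : g@_U_(1) = 0 /\ - f@_U_(1) = 0.
      apply: ind; rewrite comb !mulNr -E' [g@_U_(0) * _]mulrC subrr.
      by rewrite [f@_U_(1) * _]mulrC subrr !scale0r addr0.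
    have [g0 f0] : g@_U_(0) = 0 /\ - f@_U_(0) = 0.
      apply: ind; rewrite comb !mulNr E' [g@_U_(0) * _]mulrC subrr.
      by rewrite [f@_U_(0) * _]mulrC subrr !scale0r addr0.
    move/eqP: f0; move/eqP: f1; rewrite !oppr_eq0 => /eqP f1 /eqP f0.
    by rewrite (linear_formE hf) f0 f1 !scale0r addr0.
  have := ind 1 0; rewrite f0 scaler0 scale0r addr0 => /(_ erefl) [/eqP].
  by rewrite oner_eq0.
move=> E; have b0 : b = 0.
  have := congr1 (meval (root_pt f)) E.
  rewrite mevalD !mevalZ meval_root_pt // mulr0 add0r meval0 => /eqP.
  by rewrite mulf_eq0 (negPf g0) orbF => /eqP.
split=> //; move: E; rewrite b0 scale0r addr0 => /eqP.
rewrite -mul_mpolyC mulf_eq0 mpolyC_eq0 => /orP [/eqP //|/eqP f0].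
by move: g0; rewrite f0 meval_linear // /root_pt /= !mcoeff0 oppr0 !mulr0 addr0 eqxx.
Qed.

Lemma proportional_of_vanish f g : linear_form f -> linear_form g ->
  g.@[root_pt f] = 0 -> exists2 c : K, c != 0 & g = c *: f.
Proof.
move=> lf [hg g0] gf; have [q hq Eg] := form_vanish_dvd hg lf gf.
move: Eg; rewrite (dhomog0_const hq) mul_mpolyC => Eg.
exists q@_0 => //; apply: contraNneq g0 => q0.
by rewrite Eg q0 scale0r.
Qed.

Lemma dividesZl (c : K) l f : c != 0 -> divides (c *: l) f <-> divides l f.
Proof.
move=> c0; split=> [[q ->]|[q ->]]; first by exists (c *: q); rewrite -scalerAr scalerAl.
by exists (c^-1 *: q); rewrite -scalerAr -scalerAl scalerA divff ?scale1r.
Qed.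


(** A root of the dehomogenized polynomial p is a zero with last coordinate 1;
    when p is a constant, its coefficient in degree d.+1 is 0 and the point at
    infinity is a zero. *)
Lemma form_has_root d f : f \is d.+1.-homog ->
  exists2 l, linear_form l & f.@[root_pt l] = 0.
Proof.
move=> hf.
have lin2 (a b : K) : (a != 0) || (b != 0) ->
    exists2 l : S, linear_form l &
      forall i, root_pt l i = if i == 0 then a else b.
  have h : (- b *: 'X_0 + a *: 'X_1 : S) \is 1.-homog.
    by apply: dhomogD; apply: dhomogZ; rewrite dhomogX /= mdeg1.
  move=> ab; exists (- b *: 'X_0 + a *: 'X_1).
    split=> //; apply/eqP => E; move: ab.
    have := congr1 (mcoeff U_(0%R)) E; have := congr1 (mcoeff U_(1%R)) E.
    rewrite !mcoeffD !mcoeffZ !mcoeffXU !mcoeff0 /= !mulr1 !mulr0 add0r addr0.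
    by move=> -> /eqP; rewrite oppr_eq0 => /eqP ->; rewrite eqxx.
  move=> i; rewrite /root_pt !mcoeffD !mcoeffZ !mcoeffXU /= !mulr1 !mulr0.
  by rewrite add0r addr0 opprK.
have lift0 : lift ord0 ord0 = 1 :> 'I_2 by apply: val_inj.
have ev (l : S) (a b : K) : (forall i, root_pt l i = if i == 0 then a else b) ->
    f.@[root_pt l] = \sum_(m <- msupp f) f@_m * (a ^+ m 0 * b ^+ m 1).
  move=> E; rewrite mevalE; apply: eq_bigr => m _.
  by rewrite big_ord_recl big_ord1 lift0 !E.
have deg (m : 'X_{1..2}) : m \in msupp f -> (m 0%R + m 1%R = d.+1)%N.
  by move/(dhomog_mf hf) => /= <-; rewrite mdegE big_ord_recl big_ord1 lift0.
pose p : {poly K} := \sum_(m <- msupp f) f@_m *: 'X^(m 0).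
have pE a : p.[a] = \sum_(m <- msupp f) f@_m * (a ^+ m 0 * 1 ^+ m 1).
  rewrite horner_sum; apply: eq_bigr => m _.
  by rewrite hornerZ hornerXn expr1n mulr1.
have pd : p`_d.+1 = \sum_(m <- msupp f) f@_m * (1 ^+ m 0 * 0 ^+ m 1).
  rewrite coef_sum big_seq [RHS]big_seq; apply: eq_bigr => m /deg Em.
  rewrite coefZ coefXn expr1n mul1r; congr (_ * _).
  by rewrite -Em -{2}[m 0]addn0 eqn_add2l expr0n.
have [p0|p0] := eqVneq p`_d.+1 0.
  have [|l ll El] := lin2 1 0; first by rewrite oner_eq0.
  by exists l; rewrite // (ev _ _ _ El) -pd.
have /closed_rootP [a /rootP ra] : size p != 1%N.
  by apply: contra_neq p0 => sp; apply: nth_default; rewrite sp.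
have [|l ll El] := lin2 a 1; first by rewrite oner_eq0 orbT.
by exists l; rewrite // (ev _ _ _ El) -pE.
Qed.

Lemma expX_homog (i : 'I_2) e : ('X_i ^+ e : S) \is e.-homog.
Proof.
have /(dhomogMn e) : ('X_i : S) \is 1.-homog by rewrite dhomogX /= mdeg1.
by rewrite mul1n.
Qed.

Lemma lin_indep_sym f g : lin_indep f g -> lin_indep g f.
Proof. by move=> H a b; rewrite addrC => /H []. Qed.

Lemma lin_indepNl f g : lin_indep f g -> lin_indep (- f) g.
Proof.
move=> H a b; rewrite scalerN -scaleNr => /H [/eqP]; rewrite oppr_eq0 => /eqP.
by [].
Qed.

Lemma linear_formN f : linear_form f -> linear_form (- f).
Proof. by case=> hf f0; split; rewrite ?dhomogN ?oppr_eq0. Qed.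

Lemma lin_indep_nonvanishing f g : linear_form f -> linear_form g -> lin_indep f g ->
  g.@[root_pt f] != 0.
Proof. by move=> [hf _] [hg _] /(lin_indep_vanish hf hg). Qed.

Lemma lin_indep_nonvanishingN f g : linear_form f -> linear_form g -> lin_indep f g ->
  g.@[root_pt (- f)] != 0.
Proof. by move=> lf lg /lin_indepNl; apply: lin_indep_nonvanishing => //; apply: linear_formN. Qed.

End BinaryForms.

(** * Ideals generated by forms *)

Section Ideals.
Context {K : closedFieldType}.
Local Open Scope classical_set_scope.
Local Notation S := {mpoly K[2]}.
Implicit Types (I J A : set S) (f g l h : S) (B : seq S).

Lemma ideal_sum J (T : eqType) (s : seq T) (F : T -> S) :
  ideal J -> (forall x, x \in s -> J (F x)) -> J (\sum_(x <- s) F x).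
Proof.
case=> J0 JD _ JF; rewrite big_seq.
by apply: big_ind => // x y; apply: JD.
Qed.

Lemma generated_ideal A : ideal (generated A).
Proof.
split=> [|f g [s sA ->] [s' s'A ->]|f g [s sA ->]].
- by exists [::]; rewrite ?big_nil.
- exists (s ++ s'); last by rewrite big_cat.
  by move=> p; rewrite mem_cat => /orP [/sA|/s'A].
- exists [seq (f * p.1, p.2) | p <- s]; first by move=> p /mapP [q /sA Aq ->].
  by rewrite big_map mulr_sumr; apply: eq_bigr => p _; rewrite mulrA.
Qed.

Lemma mem_generated A f : A f -> generated A f.
Proof.
move=> Af; exists [:: (1, f)]; last by rewrite big_seq1 mul1r.
by move=> p; rewrite inE => /eqP ->.
Qed.

Lemma generated_min A J : ideal J -> A `<=` J -> generated A `<=` J.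
Proof.
move=> iJ AJ f [s sA ->]; apply: ideal_sum => // p /sA /AJ.
by case: iJ => _ _; apply.
Qed.

Lemma vanishing_ideal (P : 'I_2 -> K) : ideal [set f : S | f.@[P] = 0].
Proof.
split=> [|f g /= f0 g0|f g /= g0]; rewrite /= ?meval0 //.
  by rewrite mevalD f0 g0 addr0.
by rewrite mevalM g0 mulr0.
Qed.

(** Induction on t, applied to the colon ideals (J : X_i). Monomials are written
    as products over sequences of indices, which makes it trivial to split a
    monomial of degree t + e into factors of degrees t and e. *)
Lemma ideal_exp_monomials J t : ideal J ->
  (forall s : seq 'I_2, size s = t -> J (\prod_(i <- s) 'X_i)) ->
  ideal_exp maxideal t `<=` J.
Proof.
elim: t J => [|t IH] J iJ JX.
  move=> f _; have := JX [::] erefl; rewrite big_nil => J1.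
  by case: iJ => _ _ /(_ f _ J1); rewrite mulr1.
case: (iJ) => J0 JD JM; apply: generated_min => // _ [f [g [Mf Mg ->]]].
have JXg i : J ('X_i * g).
  have iJi : ideal [set g : S | J ('X_i * g)].
    split=> [|x y /= Jx Jy|x y /= Jy] /=; rewrite ?mulr0 //.
      by rewrite mulrDr; apply: JD.
    by rewrite mulrCA; apply: JM.
  apply: (IH _ iJi) Mg => s ss /=.
  by have := JX (i :: s); rewrite /= big_cons ss => /(_ erefl).
case: Mf => s sX ->; rewrite mulr_suml; apply: ideal_sum => // p /sX [i ->].
by rewrite -mulrA; apply: JM.
Qed.

Lemma expX_maxideal i t : ideal_exp (@maxideal K) t ('X_i ^+ t).
Proof.
elim: t => [|t IH] //=; apply: mem_generated; exists 'X_i, ('X_i ^+ t).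
by split=> //; [apply: mem_generated; exists i | rewrite exprS].
Qed.

Lemma monomial_homog (s : seq 'I_2) : \prod_(i <- s) ('X_i : S) \is (size s).-homog.
Proof.
elim: s => [|i s IH]; first by rewrite big_nil; apply: dhomog1.
rewrite big_cons -[size _]/(1 + size s)%N.
by apply: dhomogM; rewrite // dhomogX /= mdeg1.
Qed.

Definition no_common_zero J : Prop := forall l, linear_form l ->
  exists f d, [/\ J f, f \is d.-homog & f.@[root_pt l] != 0].

(** Induction on the degree of g: if g = q l and f in J is a form not vanishing
    at the zero of l, then every form of degree deg f lies in (l) + J, so
    M^t <= (q) + J gives M^(t + deg f) <= (q l) + J. *)
Lemma maxideal_exp_sub_of_form J g d : ideal J -> no_common_zero J ->
  g \is d.-homog -> g != 0 ->
  exists t, forall s : seq 'I_2, size s = t ->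
    exists q, J (\prod_(i <- s) 'X_i - q * g).
Proof.
move=> iJ ncJ; case: (iJ) => J0 JD JM; elim: d g => [|d IH] g hg g0.
  move: g0; rewrite (dhomog0_const hg) mpolyC_eq0; set c := g@_0 => c0.
  exists 0%N => s _; exists ((c^-1)%:MP * \prod_(i <- s) 'X_i).
  by rewrite mulrAC -mpolyCM mulVf // mpolyC1 mul1r subrr.
have [l ll gl] := form_has_root hg.
have [q hq Eg] := form_vanish_dvd hg ll gl.
have q0 : q != 0 by apply: contraNneq g0 => q0; rewrite Eg q0 mul0r.
have [t Ht] := IH _ hq q0.
have [f [e [Jf hf fl]]] := ncJ _ ll.
have He s : size s = e -> exists h, J (\prod_(i <- s) 'X_i - h * l).
  move=> ss; set m : S := \prod_(i <- s) _.
  have hm : m \is e.-homog by rewrite -ss; apply: monomial_homog.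
  pose c := m.@[root_pt l] / f.@[root_pt l].
  have [h Eh] : divides l (m - c *: f).
    apply/(divides_vanish (d := e)) => //; first by apply: dhomogD; rewrite ?dhomogN ?dhomogZ.
    by rewrite mevalB mevalZ /c divfK // subrr.
  by exists h; rewrite -Eh opprB addrC subrK -mul_mpolyC; apply: JM.
exists (t + e)%N => s ss.
have [a Ja] := Ht (take t s) (size_takel (leq_trans (leq_addr e t) (eq_leq (esym ss)))).
have [|b Jb] := He (drop t s); first by rewrite size_drop ss addKn.
exists (a * b); rewrite Eg -{1}(cat_take_drop t s) big_cat /=.
set x := \prod_(i <- take t s) _ in Ja *; set y := \prod_(i <- drop t s) _ in Jb *.
have -> : x * y - a * b * (q * l) = y * (x - a * q) + (a * q) * (y - b * l) by ring.
by apply: JD; apply: JM.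
Qed.

Lemma maxideal_exp_sub J : ideal J -> no_common_zero J ->
  exists t, ideal_exp maxideal t `<=` J.
Proof.
move=> iJ ncJ; case: (iJ) => J0 JD JM.
have lX : linear_form ('X_0 : S).
  split; first by rewrite dhomogX /= mdeg1.
  by rewrite -msupp_eq0 msuppX.
have [g [d [Jg hg g0]]] := ncJ _ lX.
have {}g0 : g != 0 by apply: contraNneq g0 => ->; rewrite meval0.
have [t Ht] := maxideal_exp_sub_of_form iJ ncJ hg g0.
exists t; apply: ideal_exp_monomials => // s /Ht [q Jq].
by rewrite -[X in J X](subrK (q * g)); apply: JD => //; apply: JM.
Qed.

(** Take the component of degree d of every product: generators of degree above
    d contribute nothing. *)
Lemma generated_form A f d : (forall g, A g -> exists e, g \is e.-homog) ->
  generated A f -> f \is d.-homog ->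
  exists2 s : seq (S * S), (forall p, p \in s -> A p.2 /\
      exists2 e, (e <= d)%N & p.2 \is e.-homog /\ p.1 \is (d - e).-homog)
    & f = \sum_(p <- s) p.1 * p.2.
Proof.
move=> Ah [s sA Ef] hf.
have : exists2 s' : seq (S * S), (forall p, p \in s' -> A p.2 /\
      exists2 e, (e <= d)%N & p.2 \is e.-homog /\ p.1 \is (d - e).-homog)
    & pihomog mdeg d f = \sum_(p <- s') p.1 * p.2.
  rewrite {}Ef; elim: s sA {hf f} => [|p s IH] sA.
    by exists [::] => //; rewrite !big_nil pihomog0.
  have [|s' s'A E'] := IH; first by move=> x xs; apply: sA; rewrite inE xs orbT.
  have Ap := sA p (mem_head _ _); have [e he] := Ah _ Ap.
  rewrite big_cons pihomogD E' (pihomogM_homog _ _ he).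
  case: leqP => ed; last by exists s' => //; rewrite add0r.
  exists ((pihomog mdeg (d - e) p.1, p.2) :: s'); last by rewrite big_cons.
  move=> x; rewrite inE => /predU1P [->|/s'A //] /=.
  by split=> //; exists e => //; split=> //; apply: pihomogP.
by rewrite pihomog_dE.
Qed.

End Ideals.

(** * Standard bases and essential elements *)

Section StandardBases.
Context {K : closedFieldType}.
Local Open Scope classical_set_scope.
Local Notation S := {mpoly K[2]}.
Implicit Types (I J A : set S) (f g l h : S) (B : seq S).

Definition subspace (V : lmodType K) (W : set V) : Prop :=
  [/\ W 0, forall x y, W x -> W y -> W (x + y) & forall (c : K) x, W x -> W (c *: x)].

Lemma subspace_sum (V : lmodType K) (W : set V) (T : eqType) (s : seq T) (F : T -> V) :
  subspace W -> (forall x, x \in s -> W (F x)) -> W (\sum_(x <- s) F x).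
Proof.
case=> W0 WD _ WF; rewrite big_seq.
by apply: big_ind => // x y; apply: WD.
Qed.

Lemma prev_degree_part_subspace I d : ideal I -> subspace (prev_degree_part I d).
Proof.
case=> I0 ID IM; split=> [|_ _ [s sI ->] [s' s'I ->]|c _ [s sI ->]].
- by exists [::]; rewrite ?big_nil.
- exists (s ++ s'); last by rewrite big_cat.
  by move=> p; rewrite mem_cat => /orP [/sI|/s'I].
- exists [seq (c *: p.1, p.2) | p <- s].
    move=> p /mapP [q /sI [Iq [e Ee he] h1] ->] /=; split=> //.
      by rewrite -mul_mpolyC; apply: IM.
    by exists e => //; apply: dhomogZ.
  by rewrite big_map scaler_sumr; apply: eq_bigr => p _; rewrite scalerAl.
Qed.

(** Steinitz exchange modulo a subspace, by the kernel of a matrix with more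
    rows than columns. *)
Lemma indep_leq_span (V : lmodType K) (W : set V) n m (x : 'I_n -> V) (y : 'I_m -> V) :
  subspace W ->
  (forall i, exists c : 'I_m -> K, W (x i - \sum_j c j *: y j)) ->
  (forall c : 'I_n -> K, W (\sum_i c i *: x i) -> forall i, c i = 0) ->
  (n <= m)%N.
Proof.
move=> sW span indep; case: (sW) => W0 WD WZ.
have [a Wa] := choice span.
pose M : 'M[K]_(n, m) := \matrix_(i, j) a i j.
rewrite leqNgt; apply/negP => lt_mn.
have : ~~ row_free M.
  by rewrite /row_free neq_ltn (leq_ltn_trans (rank_leq_col M)).
rewrite -kermx_eq0 => /rowV0Pn [u]; rewrite sub_kermx => /eqP uM /rV0Pn.
case=> i /eqP; apply; apply: (indep (u 0)).
have -> : \sum_i u 0 i *: x i = \sum_i u 0 i *: (x i - \sum_j a i j *: y j).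
  under [RHS]eq_bigr do rewrite scalerBr scaler_sumr.
  rewrite sumrB exchange_big /= [X in _ - X]big1 ?subr0 // => j _.
  under eq_bigr do rewrite scalerA; rewrite -scaler_suml.
  have := congr1 (fun N : 'rV_m => N 0 j) uM; rewrite !mxE.
  by under eq_bigr do rewrite mxE; move=> ->; rewrite scale0r.
by apply: subspace_sum => // k _; apply/WZ/Wa.
Qed.

Variables (I : set S) (B : seq S).
Hypothesis sbB : standard_basis I B.

Lemma standard_basis_ideal : ideal I.
Proof. by case: sbB => _ -> _; apply: generated_ideal. Qed.

Lemma standard_basis_mem f : f \in B -> I f.
Proof. by case: sbB => _ -> _ fB; apply: mem_generated. Qed.

Lemma standard_basis_neq0 f : f \in B -> f != 0.
Proof.
move=> fB; apply/eqP => f0; case: sbB => _ _ /(_ 0%N) [_ indep].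
have f0B : f \in [seq f <- B | f \is 0.-homog].
  by rewrite mem_filter fB f0 dhomog0.
have lt_i : (index f [seq f <- B | f \is 0.-homog] <
    size [seq f <- B | f \is 0.-homog])%N by rewrite index_mem.
suff E : \sum_i (i == Ordinal lt_i)%:R *: [seq f <- B | f \is 0.-homog]`_i = 0.
  have [prev0 _ _] := prev_degree_part_subspace 0 standard_basis_ideal.
  have := indep (fun i => (i == Ordinal lt_i)%:R).
  by rewrite E => /(_ prev0 (Ordinal lt_i)) /eqP; rewrite eqxx oner_eq0.
apply: big1 => i _; case: eqP => [->|_]; last by rewrite scale0r.
by rewrite /= nth_index // f0 scaler0.
Qed.

Lemma standard_basis_homog f : f \in B -> f \is (form_deg f).-homog.
Proof. by case: sbB => h _ _ /h [d]; apply: dhomog_msize. Qed.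

Lemma form_deg_homog d f : f \in B -> (form_deg f == d) = (f \is d.-homog).
Proof.
move=> fB; apply/eqP/idP => [<-|hf]; first exact: standard_basis_homog.
exact: form_degE (standard_basis_neq0 fB) hf.
Qed.

Lemma standard_basis_uniq : uniq B.
Proof.
apply: count_mem_uniq => f; have [fB|/count_memPn -> //] := boolP (f \in B).
set d := form_deg f; set Bd := [seq g <- B | g \is d.-homog].
have fBd : f \in Bd by rewrite mem_filter fB standard_basis_homog.
suff /(count_uniq_mem f) : uniq Bd.
  rewrite fBd count_filter => <-; apply: eq_in_count => g gB /=.
  by case: eqP => //= ->; rewrite standard_basis_homog.
apply/negPn/negP => /(uniqPn 0) [i [j [ij jB Eij]]].
have iB := ltn_trans ij jB.
pose c (k : 'I_(size Bd)) : K := (k == Ordinal iB)%:R - (k == Ordinal jB)%:R.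
have E : \sum_k c k *: Bd`_k = 0.
  rewrite /c; under eq_bigr do rewrite scalerBl; rewrite sumrB.
  rewrite (bigD1 (Ordinal iB)) //= big1 => [|k /negPf ->]; last by rewrite scale0r.
  rewrite (bigD1 (Ordinal jB)) //= big1 => [|k /negPf ->]; last by rewrite scale0r.
  by rewrite !eqxx Eij subrr.
have [prev0 _ _] := prev_degree_part_subspace d standard_basis_ideal.
case: sbB => _ _ /(_ d) [_ /(_ c)]; rewrite E => /(_ prev0 (Ordinal iB)) /eqP.
rewrite /c eqxx.
have -> : (Ordinal iB == Ordinal jB) = false by apply/eqP => -[E']; rewrite E' ltnn in ij.
by rewrite subr0 oner_eq0.
Qed.

End StandardBases.

Section Essential.
Context {K : closedFieldType}.
Local Open Scope classical_set_scope.
Local Notation S := {mpoly K[2]}.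
Implicit Types (I J A : set S) (f g l h : S) (B : seq S).

(** In degree d both give a basis of the quotient of I_d by I_(d-1) S_1. *)
Lemma standard_basis_leq_size I B B' d :
  standard_basis I B -> standard_basis I B' ->
  (size [seq f <- B | f \is d.-homog] <= size [seq f <- B' | f \is d.-homog])%N.
Proof.
move=> sB sB'; case: (sB) => _ _ /(_ d) [_ indep]; case: (sB') => _ _ /(_ d) [span _].
have sW := prev_degree_part_subspace d (standard_basis_ideal sB).
apply: (indep_leq_span sW _ indep) => i; apply: span.
  apply: (standard_basis_mem sB).
  by have := mem_nth 0 (ltn_ord i); rewrite mem_filter => /andP [].
by have := mem_nth 0 (ltn_ord i); rewrite mem_filter => /andP [].
Qed.

Lemma generated_nonvanishing A g d (P : 'I_2 -> K) :
  (forall f, A f -> exists e, f \is e.-homog) ->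
  generated A g -> g \is d.-homog -> g.@[P] != 0 ->
  exists f e, [/\ A f, f \is e.-homog, (e <= d)%N & f.@[P] != 0].
Proof.
move=> Ah Ag hg gP; apply: contrapT => none.
have [s sA Eg] := generated_form Ah Ag hg; move/eqP: gP; apply.
have : [set f : S | f.@[P] = 0] (\sum_(p <- s) p.1 * p.2).
  apply: (ideal_sum (vanishing_ideal P)) => p /sA [Ap [e ed [h2 h1]]] /=.
  rewrite mevalM; have [->|nz] := eqVneq p.2.@[P] 0; first by rewrite mulr0.
  by case: none; exists p.2, e.
by rewrite /= -Eg.
Qed.

(** The forms of B other than f generate an ideal J. If they all vanish at a
    point where f does not, no power of a variable nonzero at that point
    multiplies f into J; otherwise J has no zero on the projective line and
    contains a power of the maximal ideal. *)
Lemma essentialP I B f : standard_basis I B -> no_common_zero I -> f \in B ->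
  essential B f <-> exists l, [/\ linear_form l, f.@[root_pt l] != 0
    & forall g, g \in B -> g != f -> g.@[root_pt l] = 0].
Proof.
move=> sB ncI fB; have Bh g : g \in B -> exists e, g \is e.-homog by case: sB => + _ _; apply.
split=> [ess|[l [ll fl gl]] [t Ht]]; last first.
  have [i li] : exists i, root_pt l i != 0 by apply/linear_form_neq0P; case: ll.
  have van := generated_min (vanishing_ideal (root_pt l)) _ (Ht _ (expX_maxideal i t)).
  have /eqP : (f * 'X_i ^+ t).@[root_pt l] = 0.
    by apply: van => h /=; rewrite mem_filter => /andP [hf hB]; apply: gl.
  by rewrite mevalM rmorphXn /= mevalXU mulf_eq0 (negPf fl) expf_eq0 (negPf li) andbF.
apply: contrapT => none; apply: ess.
set A := [set h | h \in [seq h <- B | h != f]].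
have iA := generated_ideal A.
have [|t tJ] := maxideal_exp_sub iA; last first.
  exists t => g /tJ Jg; by case: iA => _ _; apply.
move=> l ll; have [g [d [Ig hg gl]]] := ncI _ ll.
have [b bB [bf bl]] : exists2 b, b \in B & b != f /\ b.@[root_pt l] != 0.
  have [b [e [bB hb ed bl]]] : exists b e, [/\ b \in B, b \is e.-homog, (e <= d)%N
      & b.@[root_pt l] != 0].
    by apply: (generated_nonvanishing (A := [set f | f \in B])) hg gl => //; case: sB => _ <-.
  have [Ebf|] := eqVneq b f; last by exists b.
  apply: contrapT => none'; apply: none; exists l; split=> //; first by rewrite -Ebf.
  move=> x xB xf; apply/eqP/negPn/negP => xl; apply: none'; by exists x.
have [e he] := Bh _ bB; exists b, e; split=> //.
by apply: mem_generated; rewrite /A /= mem_filter bf.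
Qed.

End Essential.

(** * Maximal minors of a bidiagonal matrix *)

(** The data of an upper bidiagonal matrix with [len] rows and one more column:
    [lin] is its superdiagonal and [dia] the opposite of its diagonal, so that the
    signed maximal minors are products without sign. The last field says that the
    diagonal entries down to row j are nonzero at the zero of the superdiagonal
    entry of row j; it is what allows division by the superdiagonal entries. *)
Record chain (K : closedFieldType) := Chain {
  len : nat;
  lin : nat -> {mpoly K[2]};
  dia : nat -> {mpoly K[2]};
  ddeg : nat -> nat;
  lin_linear : forall i, (i < len)%N -> linear_form (lin i);
  dia_homog : forall i, (i < len)%N -> dia i \is (ddeg i).-homog;
  ddeg_gt0 : forall i, (i < len)%N -> (0 < ddeg i)%N;
  dia_nonvanishing : forall i j, (i <= j < len)%N ->
    (dia i).@[root_pt (lin j)] != 0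
}.

Section Chain.
Context {K : closedFieldType}.
Local Open Scope classical_set_scope.
Local Notation S := {mpoly K[2]}.
Variable C : chain K.
Local Notation N := (len C).

Definition diaprod (j : nat) : S := \prod_(0 <= i < j) dia C i.
Definition linprod (j : nat) : S := \prod_(j <= i < N) lin C i.
Definition minor (j : nat) : S := diaprod j * linprod j.
Definition diaprod_deg (j : nat) : nat := \sum_(0 <= i < j) ddeg C i.
Definition minor_deg (j : nat) : nat := diaprod_deg j + (N - j).
Definition minors : seq S := [seq minor j | j <- iota 0 N.+1].
Definition minor_ideal : set S := generated [set f | f \in minors].

Lemma diaprod_deg_recr j : diaprod_deg j.+1 = (diaprod_deg j + ddeg C j)%N.
Proof. by rewrite /diaprod_deg big_nat_recr. Qed.

Lemma diaprod_recr j : diaprod j.+1 = diaprod j * dia C j.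
Proof. by rewrite /diaprod big_nat_recr. Qed.

Lemma linprod_recl j : (j < N)%N -> linprod j = lin C j * linprod j.+1.
Proof. by move=> ltj; rewrite /linprod big_ltn. Qed.

Lemma diaprod0 : diaprod 0 = 1. Proof. by rewrite /diaprod big_geq. Qed.
Lemma linprod_len : linprod N = 1. Proof. by rewrite /linprod big_geq. Qed.

Lemma diaprod_homog j : (j <= N)%N -> diaprod j \is (diaprod_deg j).-homog.
Proof.
elim: j => [|j IH] ltj; first by rewrite diaprod0 /diaprod_deg big_geq //; apply: dhomog1.
by rewrite diaprod_recr diaprod_deg_recr; apply: dhomogM; rewrite ?IH ?dia_homog // ltnW.
Qed.

Lemma linprod_homog j : (j <= N)%N -> linprod j \is (N - j).-homog.
Proof.
move=> lejN; rewrite -{1}(subKn lejN); elim: (N - j)%N (leq_subr j N) => [|k IH] ltk.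
  by rewrite subn0 linprod_len; apply: dhomog1.
have lt_sub : (N - k.+1 < N)%N by rewrite ltn_subrL (leq_trans _ ltk).
rewrite linprod_recl // subnSK // -[k.+1]/(1 + k)%N; apply: dhomogM.
  by case: (lin_linear lt_sub).
by rewrite IH // ltnW.
Qed.

Lemma minor_homog j : (j <= N)%N -> minor j \is (minor_deg j).-homog.
Proof. by move=> lej; apply: dhomogM; rewrite ?diaprod_homog ?linprod_homog. Qed.

Lemma diaprod_nonvanishing i j : (i <= j.+1)%N -> (j < N)%N ->
  (diaprod i).@[root_pt (lin C j)] != 0.
Proof.
move=> leij ltj; rewrite /diaprod big_nat rmorph_prod /= -big_nat prodf_seq_neq0.
apply/allP => k; rewrite mem_index_iota => /andP [_ ltki] /=.
by apply: dia_nonvanishing; rewrite -ltnS (leq_trans ltki leij).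
Qed.

Lemma dia_neq0 i : (i < N)%N -> dia C i != 0.
Proof.
move=> lti; have := @dia_nonvanishing _ C i i; rewrite leqnn lti => /(_ isT).
by apply: contraNneq => ->; rewrite meval0.
Qed.

Lemma linprod_neq0 j : linprod j != 0.
Proof.
rewrite /linprod prodf_seq_neq0; apply/allP => k; rewrite mem_index_iota => /andP [_ /lin_linear].
by case.
Qed.

Lemma minor_neq0 j : (j <= N)%N -> minor j != 0.
Proof.
move=> lej; rewrite mulf_neq0 ?linprod_neq0 // /diaprod prodf_seq_neq0.
apply/allP => k; rewrite mem_index_iota => /andP [_ ltkj] /=.
exact/dia_neq0/(leq_trans ltkj).
Qed.

Lemma minor_homogE j d : (j <= N)%N -> (minor j \is d.-homog) = (minor_deg j == d).
Proof.
move=> lej; apply/idP/eqP => [h|<-]; last exact: minor_homog.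
exact: dhomog_uniq (minor_neq0 lej) (minor_homog lej) h.
Qed.

Lemma minor_degS j : (j < N)%N -> (minor_deg j.+1).+1 = (minor_deg j + ddeg C j)%N.
Proof.
move=> ltj; rewrite /minor_deg diaprod_deg_recr -addnS subnSK //.
by rewrite addnAC.
Qed.

Lemma minor_deg_homo i j : (i <= j <= N)%N -> (minor_deg i <= minor_deg j)%N.
Proof.
case/andP; elim: j => [|j IH]; first by rewrite leqn0 => /eqP ->.
rewrite leq_eqVlt => /predU1P [->|] // leij ltj; apply: (leq_trans (IH _ _)) => //.
  exact: ltnW.
rewrite -ltnS minor_degS // -addn1 leq_add2l.
exact: ddeg_gt0.
Qed.

Lemma linprod_dvd i j : (i <= j)%N -> exists q, linprod i = q * linprod j.
Proof.
case: (leqP j N) => [lejN leij|ltNj _]; last first.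
  exists (linprod i); by rewrite [linprod j]/linprod big_geq ?mulr1 // ltnW.
exists (\prod_(i <= k < j) lin C k); by rewrite /linprod -big_cat_nat.
Qed.

Lemma minor_ideal_ideal : ideal minor_ideal.
Proof. exact: generated_ideal. Qed.

Lemma mem_minors j : (j <= N)%N -> minor j \in minors.
Proof. by move=> lej; apply: map_f; rewrite mem_iota. Qed.

Lemma minorsP f : f \in minors -> exists2 j, (j <= N)%N & f = minor j.
Proof. by case/mapP => j; rewrite mem_iota => lej ->; exists j. Qed.

Lemma minors_homog f : f \in minors -> exists e, f \is e.-homog.
Proof. by case/minorsP => j lej ->; exists (minor_deg j); apply: minor_homog. Qed.

Lemma minor_in_ideal j : (j <= N)%N -> minor_ideal (minor j).
Proof. by move=> lej; apply: mem_generated => /=; apply: mem_minors. Qed.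

(** Modulo lin j the forms of degree e make up a line, spanned by any form that
    does not vanish at the zero of lin j; a monomial multiple of diaprod j.+1 is
    such a form. *)
Lemma diaprod_division j e g : (j < N)%N -> (diaprod_deg j.+1 <= e)%N -> g \is e.-homog ->
  exists a q, [/\ a \is (e - diaprod_deg j.+1).-homog, q \is e.-1.-homog
    & g = a * diaprod j.+1 + q * lin C j].
Proof.
move=> ltj le_e hg; have ll := lin_linear ltj.
have [i Pi] : exists i, root_pt (lin C j) i != 0 by apply/linear_form_neq0P; case: ll.
pose x : S := 'X_i ^+ (e - diaprod_deg j.+1).
have hx : x \is (e - diaprod_deg j.+1).-homog.
  exact: expX_homog.
have hxh : x * diaprod j.+1 \is e.-homog.
  by rewrite -{1}(subnK le_e); apply: dhomogM => //; apply: diaprod_homog.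
have xh0 : (x * diaprod j.+1).@[root_pt (lin C j)] != 0.
  by rewrite mevalM mulf_neq0 ?diaprod_nonvanishing // rmorphXn /= mevalXU expf_neq0.
pose c := g.@[root_pt (lin C j)] / (x * diaprod j.+1).@[root_pt (lin C j)].
have e_gt0 : (0 < e)%N.
  by apply: leq_trans le_e; rewrite diaprod_deg_recr addn_gt0 ddeg_gt0 ?orbT.
have [||q hq Eq] := @form_vanish_dvd K e.-1 (g - c *: (x * diaprod j.+1)) _ _ ll.
- by rewrite prednK //; apply: dhomogD; rewrite ?dhomogN ?dhomogZ.
- by rewrite mevalB mevalZ divfK // subrr.
exists (c *: x), q; split=> //; first exact: dhomogZ.
by rewrite -Eq -scalerAl addrC subrK.
Qed.

(** Induction on j: dividing g by lin j splits off a multiple of the minor of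
    index j.+1 and leaves a multiple of linprod j. *)
Lemma linprod_mul_in_ideal j e g : (j <= N)%N -> (diaprod_deg j <= e)%N ->
  g \is e.-homog -> minor_ideal (linprod j * g).
Proof.
have [J0 JD JM] := minor_ideal_ideal.
elim: j e g => [|j IH] e g lej le_e hg.
  by rewrite mulrC; apply: JM; rewrite -[linprod 0]mul1r -diaprod0; apply: minor_in_ideal.
have [a [q [_ hq ->]]] := diaprod_division lej le_e hg.
rewrite mulrDr mulrCA; apply: JD.
  by apply: JM; rewrite mulrC; apply: minor_in_ideal.
rewrite mulrCA [linprod _ * _]mulrC -linprod_recl // mulrC; apply: (IH e.-1) => //.
  exact: ltnW.
rewrite -ltnS prednK; last by apply: leq_trans le_e; rewrite diaprod_deg_recr addn_gt0 ddeg_gt0 ?orbT.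
by apply: leq_trans le_e; rewrite diaprod_deg_recr -addn1 leq_add2l ddeg_gt0.
Qed.

(** Only the minors of degree at most d contribute to a form of degree d. *)
Lemma minor_ideal_dvd d j f : (j <= N)%N ->
  (forall i, (i <= N)%N -> (minor_deg i <= d)%N -> (i <= j)%N) ->
  minor_ideal f -> f \is d.-homog -> exists q, f = q * linprod j.
Proof.
move=> lej jmax If hf; have [s sA ->] := generated_form minors_homog If hf.
elim: s sA => [|p s IH] sA; first by exists 0; rewrite big_nil mul0r.
have [|q Eq] := IH; first by move=> x xs; apply: sA; rewrite inE xs orbT.
have [/minorsP [i lei E2] [e ed [h2 _]]] := sA p (mem_head _ _).
have Ee : minor_deg i = e by apply/eqP; rewrite -minor_homogE // -E2.
have [|r Er] := linprod_dvd (i := i) (j := j); first by apply: jmax; rewrite // Ee.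
exists (p.1 * diaprod i * r + q).
by rewrite big_cons Eq E2 /minor Er; ring.
Qed.

Lemma minor_ideal_low d f : (d < minor_deg 0)%N -> minor_ideal f -> f \is d.-homog -> f = 0.
Proof.
move=> ltd If hf; have [s sA ->] := generated_form minors_homog If hf.
rewrite big_seq big1 // => p /sA [/minorsP [i lei E2] [e ed [h2 _]]].
have Ee : minor_deg i = e by apply/eqP; rewrite -minor_homogE // -E2.
have := minor_deg_homo (i := 0) (j := i); rewrite lei Ee => /(_ isT) le0e.
by have := leq_trans (leq_trans ltd le0e) ed; rewrite ltnn.
Qed.

(** As linprod N = 1, the ideal contains all forms of large degree. *)
Lemma minor_ideal_no_common_zero : no_common_zero minor_ideal.
Proof.
move=> l ll; have [i li] : exists i, root_pt l i != 0 by apply/linear_form_neq0P; case: ll.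
have hX : ('X_i ^+ diaprod_deg N : S) \is (diaprod_deg N).-homog.
  exact: expX_homog.
exists ('X_i ^+ diaprod_deg N), (diaprod_deg N); split=> //.
  by rewrite -[X in minor_ideal X]mul1r -linprod_len; apply: linprod_mul_in_ideal hX.
by rewrite rmorphXn /= mevalXU expf_neq0.
Qed.

End Chain.

(** * The minors form a standard basis *)

Section ChainStandardBasis.
Context {K : closedFieldType}.
Local Open Scope classical_set_scope.
Local Notation S := {mpoly K[2]}.
Variable C : chain K.
Local Notation N := (len C).

Lemma prev_degree_part_mul_linprod j e g : (j <= N)%N -> (diaprod_deg C j <= e)%N ->
  g \is e.+1.-homog -> prev_degree_part (minor_ideal C) (e.+1 + (N - j)) (linprod C j * g).
Proof.
move=> lej le_e hg; rewrite [g]mpolyE mulr_sumr.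
have sW := prev_degree_part_subspace (e.+1 + (N - j)) (minor_ideal_ideal C).
apply: subspace_sum => // m /(dhomog_mf hg) /= Em.
rewrite -scalerAr; case: sW => _ _; apply.
have [i mi] : exists i, (0 < m i)%N.
  apply: contrapT => /forallNP m0.
  move: Em; rewrite mdegE big1 // => i _; apply/eqP.
  by rewrite -leqn0 leqNgt; apply/negP/m0.
have Um : (U_(i) <= m)%MM by rewrite lep1mP -lt0n.
exists [:: (linprod C j * 'X_[m - U_(i)], 'X_i)]; last first.
  by rewrite big_seq1 /= -mulrA -mpolyXD submK.
move=> p; rewrite inE => /eqP -> /=.
have hX : ('X_[m - U_(i)] : S) \is e.-homog.
  have := congr1 mdeg (submK Um); rewrite mdegD mdeg1 Em addn1 => -[Em'].
  by rewrite dhomogX /= Em'.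
split; last by rewrite dhomogX /= mdeg1.
  exact: linprod_mul_in_ideal hX.
exists (e + (N - j))%N; first by rewrite addSn.
by rewrite addnC; apply: dhomogM => //; apply: linprod_homog.
Qed.

Lemma prev_degree_part_low d f : (d <= minor_deg C 0)%N ->
  prev_degree_part (minor_ideal C) d f -> f = 0.
Proof.
move=> led [s sI ->]; rewrite big_seq big1 // => p /sI [Ip [e Ee he] _].
by rewrite (minor_ideal_low _ Ip he) ?mul0r // Ee.
Qed.

Lemma prev_degree_part_dvd j d f : (j < N)%N -> (d <= minor_deg C j.+1)%N ->
  prev_degree_part (minor_ideal C) d f -> exists q, f = q * linprod C j.
Proof.
move=> ltj led [s sI ->]; elim: s sI => [|p s IH] sI.
  by exists 0; rewrite big_nil mul0r.
have [|q Eq] := IH; first by move=> x xs; apply: sI; rewrite inE xs orbT.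
have [Ip [e Ee he] _] := sI p (mem_head _ _).
have [|i lei led'|r Er] := @minor_ideal_dvd _ C e j p.1 _ _ Ip he; first exact: ltnW.
  rewrite leqNgt; apply/negP => ltji.
  have := @minor_deg_homo _ C j.+1 i; rewrite ltji lei => /(_ isT) leji.
  by have := leq_trans (leq_trans led leji) led'; rewrite -Ee ltnn.
by exists (r * p.2 + q); rewrite big_cons Eq {1}Er; ring.
Qed.

Definition spanned_in_degree (I : set S) (d : nat) (Bd : seq S) (f : S) : Prop :=
  exists c : 'I_(size Bd) -> K, prev_degree_part I d (f - \sum_i c i *: Bd`_i).

Lemma spanned_sub I d Bd f x (a : K) : ideal I -> x \in Bd ->
  spanned_in_degree I d Bd (f - a *: x) -> spanned_in_degree I d Bd f.
Proof.
move=> iI xB [c Hc]; have lti : (index x Bd < size Bd)%N by rewrite index_mem.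
exists (fun i => a * (i == Ordinal lti)%:R + c i).
under eq_bigr do rewrite scalerDl; rewrite big_split /= opprD addrA.
rewrite (bigD1 (Ordinal lti)) //= big1 => [|i /negPf ->]; last by rewrite mulr0 scale0r.
by rewrite eqxx mulr1 addr0 nth_index.
Qed.

Lemma spanned_prev I d Bd f : prev_degree_part I d f -> spanned_in_degree I d Bd f.
Proof.
move=> pf; exists (fun=> 0); rewrite big1 ?subr0 // => i _; exact: scale0r.
Qed.

(** Induction on j: if the minor of index j has degree d, a scalar multiple of it
    is split off and a multiple of linprod j.-1 is left; if its degree is smaller,
    the product already comes from degree d - 1. *)
Lemma linprod_mul_spanned j d g : (j <= N)%N -> (minor_deg C j <= d)%N ->
  g \is (d - (N - j)).-homog ->
  spanned_in_degree (minor_ideal C) d [seq f <- minors C | f \is d.-homog] (linprod C j * g).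
Proof.
have iI := minor_ideal_ideal C.
elim: j g => [|j IH] g lej; rewrite leq_eqVlt => /predU1P [Ed|ltd] hg.
- rewrite -Ed in hg *; have : g \is 0.-homog.
    by move: hg; rewrite /minor_deg /diaprod_deg big_geq // subnn.
  move/dhomog0_const => ->; apply: (@spanned_sub _ _ _ _ (minor C 0) g@_0) => //.
    by rewrite mem_filter mem_minors // minor_homog.
  apply: spanned_prev; rewrite mulrC mul_mpolyC /minor diaprod0 mul1r subrr.
  by case: (prev_degree_part_subspace (minor_deg C 0) iI).
- apply: spanned_prev; move: hg ltd; rewrite /minor_deg /diaprod_deg big_geq // add0n.
  move=> hg ltd; have E : (d = (d - (N - 0)).-1.+1 + (N - 0))%N.
    by rewrite prednK ?subn_gt0 // subnK // ltnW.
  rewrite {1}E; apply: prev_degree_part_mul_linprod => //; first by rewrite /diaprod_deg big_geq.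
  by rewrite prednK // subn_gt0.
- have hdeg : (diaprod_deg C j.+1 = d - (N - j.+1))%N by rewrite -Ed addnK.
  have [|a [q [ha hq Eg]]] := diaprod_division lej _ hg; first by rewrite hdeg.
  move: ha; rewrite hdeg subnn => /dhomog0_const Ea.
  apply: (@spanned_sub _ _ _ _ (minor C j.+1) a@_0) => //.
    by rewrite mem_filter mem_minors // -Ed minor_homog.
  have -> : linprod C j.+1 * g - a@_0 *: minor C j.+1 = linprod C j * q.
    by rewrite Eg -mul_mpolyC -Ea /minor (linprod_recl lej); ring.
  apply: IH; first exact: ltnW.
    by rewrite -Ed minor_deg_homo // leqnSn.
  by move: hq; rewrite -subn1 -subnDA addn1 subnSK.
- apply: spanned_prev; have lt1 : (diaprod_deg C j.+1 < d - (N - j.+1))%N.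
    by rewrite ltn_subRL addnC.
  have lt2 := leq_ltn_trans (leq0n _) lt1.
  have E : (d = (d - (N - j.+1)).-1.+1 + (N - j.+1))%N.
    by rewrite prednK // subnK // ltnW // -subn_gt0.
  rewrite {1}E; apply: prev_degree_part_mul_linprod => //.
    by rewrite -ltnS prednK.
  by rewrite prednK.
Qed.

Lemma minors_filter d :
  [seq f <- minors C | f \is d.-homog] =
  [seq minor C j | j <- [seq j <- iota 0 N.+1 | minor_deg C j == d]].
Proof.
rewrite /minors filter_map; congr map; apply: eq_in_filter => j; rewrite mem_iota => lej /=.
exact: minor_homogE.
Qed.

(** Spanning descends along the chain by division by the linear forms;
    independence evaluates a relation, cleared of the common factor, at the zero
    of the linear form preceding the last minor involved. *)
Lemma minors_standard_basis : standard_basis (minor_ideal C) (minors C).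
Proof.
have iI := minor_ideal_ideal C; case: (iI) => I0 ID IM.
split=> [f||d]; first exact: minors_homog; first by [].
split=> [f If hf|].
  pose Pj j := (j <= N)%N && (minor_deg C j <= d)%N.
  have [low|le0] := ltnP d (minor_deg C 0).
    by rewrite (minor_ideal_low low If hf); apply: spanned_prev; case: (prev_degree_part_subspace d iI).
  have ex0 : exists j, Pj j by exists 0%N; apply/andP.
  have leN j : Pj j -> (j <= N)%N by case/andP.
  case: (ex_maxnP ex0 leN) => j /andP [lej led] jmax.
  have [|q Eq] := minor_ideal_dvd lej _ If hf.
    by move=> i lei le_id; apply: jmax; apply/andP.
  have Ef : f = linprod C j * pihomog mdeg (d - (N - j)) q.
    rewrite -{1}(pihomog_dE hf) Eq (pihomogM_homog _ _ (linprod_homog lej)).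
    by rewrite (leq_trans (leq_addl _ _) led) mulrC.
  by rewrite Ef; apply: linprod_mul_spanned => //; apply: pihomogP.
rewrite minors_filter; set js := [seq j <- _ | _] => c prev_c i0.
apply/eqP/negPn/negP => ci0.
case: (@arg_maxnP _ i0 (fun k => c k != 0) (fun k => k : nat) ci0) => i ci imax.
set j := nth 0%N js i.
have ltsz (k : 'I_(size [seq minor C j | j <- js])) : (k < size js)%N.
  by rewrite -(size_map (minor C) js).
have lti := ltsz i.
have /andP [/eqP Ej lejN] : (minor_deg C j == d) && (j <= N)%N.
  by have := mem_nth 0%N lti; rewrite -/j mem_filter mem_iota.
have js_sorted : sorted ltn js by apply: sorted_filter (iota_ltn_sorted _ _); apply: ltn_trans.
have lower k : k != i -> c k != 0 -> (nth 0%N js k < j)%N.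
  move=> ki ck; have ltki : (k < i)%N by rewrite ltn_neqAle (imax k ck : (k <= i)%N) andbT; apply: contra_neq ki => /val_inj.
  exact: (sorted_ltn_nth ltn_trans 0%N js_sorted _ _ (ltsz k) lti ltki).
have nthB (k : 'I_(size [seq minor C j | j <- js])) :
    [seq minor C j | j <- js]`_k = minor C (nth 0%N js k).
  by rewrite (nth_map 0%N).
move: prev_c; rewrite (bigD1 i) //= nthB -/j.
case: j Ej lejN lower => [|j] Ej lejN lower prev_c.
  move: prev_c; rewrite big1 ?addr0 => [|k /lower]; last first.
    by have [-> _|_ /(_ isT)] := eqVneq (c k) 0; rewrite ?scale0r.
  move/prev_degree_part_low; rewrite Ej leqnn => /(_ isT) /eqP.
  by rewrite -mul_mpolyC mulf_eq0 mpolyC_eq0 (negPf ci) (negPf (minor_neq0 _)).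
have [r Er] : exists r, \sum_(k | k != i) c k *: [seq minor C j | j <- js]`_k = r * linprod C j.
  apply: (@big_ind _ (fun x : S => exists r, x = r * linprod C j)) => [|x y [u ->] [v ->]|k /lower].
  - by exists 0; rewrite mul0r.
  - by exists (u + v); rewrite mulrDl.
  - have [-> _|_ /(_ isT) ltkj] := eqVneq (c k) 0; first by exists 0; rewrite scale0r mul0r.
    have [u Eu] := linprod_dvd C (ltkj : (nth 0%N js k <= j)%N).
    exists (c k *: (diaprod C (nth 0%N js k) * u)).
    by rewrite nthB /minor Eu mulrA scalerAl.
have [|q] := prev_degree_part_dvd lejN _ prev_c; first by rewrite Ej.
rewrite Er => Eq; have : c i *: minor C j.+1 = (q - r) * linprod C j.
  by rewrite mulrBl -Eq addrK.
rewrite (linprod_recl lejN) /minor scalerAl mulrA => /(mulIf (linprod_neq0 _ _)) Eh.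
have := diaprod_nonvanishing (C := C) (leqnn j.+1) lejN.
have := congr1 (meval (root_pt (lin C j))) Eh.
rewrite mevalM meval_root_pt ?mulr0; last by case: (lin_linear lejN).
by rewrite mevalZ => /eqP; rewrite mulf_eq0 (negPf ci) => /= ->.
Qed.
End ChainStandardBasis.

(** * Essential elements and the minors *)

Lemma sub_in_count (T : eqType) (a b : pred T) (s : seq T) :
  {in s, subpred a b} -> (count a s <= count b s)%N.
Proof.
elim: s => //= x s IH ab; apply: leq_add.
  by case ax: (a x); rewrite // (ab x _ ax) ?mem_head.
by apply: IH => y ys; apply: ab; rewrite inE ys orbT.
Qed.

Section ChainEssential.
Context {K : closedFieldType}.
Local Open Scope classical_set_scope.
Local Notation S := {mpoly K[2]}.
Variable C : chain K.
Local Notation N := (len C).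
Local Notation I := (minor_ideal C).

Definition last_occurrence (i : nat) : bool :=
  all (fun j => (lin C j).@[root_pt (lin C i)] != 0) (iota i.+1 (N - i.+1)).

Lemma last_occurrenceP i : reflect
  (forall j, (i < j < N)%N -> (lin C j).@[root_pt (lin C i)] != 0) (last_occurrence i).
Proof.
apply: (iffP allP) => H j; last first.
  rewrite mem_iota => /andP [ltij ltj]; apply: H; rewrite ltij /=.
  case: (ltnP i N) => [ltiN|leNi]; first by rewrite subnKC in ltj.
  move: ltj; have -> : (N - i.+1 = 0)%N by apply/eqP; rewrite subn_eq0 ltnW.
  by rewrite addn0 ltnNge ltij.
case/andP=> ltij ltj; apply: H; rewrite mem_iota ltij /= subnKC //.
exact: ltn_trans ltij ltj.
Qed.

Lemma minor_inj i j : (i <= N)%N -> (j <= N)%N -> minor C i = minor C j -> i = j.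
Proof.
move=> lei lej; have := standard_basis_uniq (minors_standard_basis C).
by move/(mkseq_uniqP (minor C)); apply; rewrite inE ltnS.
Qed.

Lemma minor_last_nonvanishing i : (i < N)%N -> last_occurrence i ->
  (minor C i.+1).@[root_pt (lin C i)] != 0.
Proof.
move=> lti /last_occurrenceP li; rewrite mevalM mulf_neq0 ?diaprod_nonvanishing //.
rewrite /linprod big_nat rmorph_prod /= -big_nat prodf_seq_neq0.
by apply/allP => k; rewrite mem_index_iota => /li.
Qed.

(** Among the superdiagonal entries proportional to l, the one of largest index
    is a last occurrence. *)
Lemma last_root l i0 : linear_form l -> (i0 < N)%N -> (lin C i0).@[root_pt l] = 0 ->
  exists i, [/\ (i0 <= i < N)%N, last_occurrence i, (lin C i).@[root_pt l] = 0
    & forall d f, f \is d.-homog ->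
      f.@[root_pt l] = 0 <-> f.@[root_pt (lin C i)] = 0].
Proof.
move=> ll lti0 z0; pose Z i := (i < N)%N && ((lin C i).@[root_pt l] == 0).
have Zi0 : Z i0 by rewrite /Z lti0 z0 eqxx.
have exZ : exists i, Z i by exists i0.
have ltZ i : Z i -> (i <= N)%N by case/andP => /ltnW.
case: (ex_maxnP exZ ltZ) => i /andP [lti /eqP zi] imax.
have [c c0 Ec] := proportional_of_vanish ll (lin_linear lti) zi.
have same d f : f \is d.-homog -> f.@[root_pt l] = 0 <-> f.@[root_pt (lin C i)] = 0.
  move=> hf; rewrite -(divides_vanish hf ll) -(divides_vanish hf (lin_linear lti)).
  by rewrite Ec; split => /(dividesZl _ _ c0).
exists i; split; rewrite ?imax //; apply/last_occurrenceP => j /andP [ltij ltj].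
apply/eqP => zj; have [hj _] := lin_linear ltj.
move/(same _ _ hj): zj => zj; have := imax j; rewrite /Z ltj zj eqxx => /(_ isT).
by rewrite leqNgt ltij.
Qed.

Lemma root_of_linprod l : linear_form l -> (linprod C 0).@[root_pt l] = 0 ->
  exists i, [/\ (i < N)%N, last_occurrence i & forall d f, f \is d.-homog ->
    f.@[root_pt l] = 0 <-> f.@[root_pt (lin C i)] = 0].
Proof.
move=> ll /eqP; rewrite /linprod rmorph_prod /= prodf_seq_eq0 => /hasP [i0].
rewrite mem_index_iota => /andP [_ lti0] /= /eqP z0.
by have [i [/andP [_ lti] li _ same]] := last_root ll lti0 z0; exists i.
Qed.

Lemma nb_linear_forms_last (cond : pred nat) (Q : S -> Prop) :
  (forall l, linear_form l -> Q l <-> exists i,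
     [/\ (i < N)%N, last_occurrence i, cond i & (lin C i).@[root_pt l] = 0]) ->
  nb_linear_forms Q (size [seq i <- iota 0 N | last_occurrence i & cond i]).
Proof.
move=> QE; set sel := [seq i <- _ | _].
have selP i : i \in sel -> [/\ (i < N)%N, last_occurrence i & cond i].
  by rewrite mem_filter mem_iota => /andP [/andP [-> ->]].
exists [seq lin C i | i <- sel]; rewrite size_map; split=> //.
  split=> [_ /mapP [i /selP [lti _ _] ->]|i j]; first exact: lin_linear.
  rewrite size_map => /andP [ltij ltj]; have lti := ltn_trans ltij ltj.
  rewrite !(nth_map 0%N) //.
  have [lti' li _] := selP _ (mem_nth 0%N lti); have [ltj' _ _] := selP _ (mem_nth 0%N ltj).
  have [hi _] := lin_linear lti'; have [hj _] := lin_linear ltj'.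
  apply/(lin_indep_vanish hi hj)/(last_occurrenceP _ li); rewrite ltj' andbT.
  have sel_sorted : sorted ltn sel.
    by apply: sorted_filter (iota_ltn_sorted _ _); apply: ltn_trans.
  exact: (sorted_ltn_nth ltn_trans 0%N sel_sorted _ _ lti ltj ltij).
move=> l ll; rewrite QE //; split=> [[i [lti li ci il]]|[_ /mapP [i /selP [lti li ci] ->] [c El]]].
  exists (lin C i); first by apply: map_f; rewrite mem_filter li ci mem_iota.
  have [c c0 Ec] := proportional_of_vanish ll (lin_linear lti) il.
  by exists c^-1; rewrite Ec scalerA mulVf // scale1r.
exists i; split=> //; have [hl l0] := ll.
have c0 : c != 0 by apply: contraNneq l0 => c0; rewrite El c0 scale0r.
have := congr1 (meval (root_pt l)) El; rewrite mevalZ meval_root_pt // => /esym /eqP.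
by rewrite mulf_eq0 (negPf c0) => /eqP.
Qed.

Hypothesis dia_next : forall i, (i.+1 < N)%N -> last_occurrence i ->
  (dia C i.+1).@[root_pt (lin C i)] = 0.
Hypothesis dia_first : exists l, [/\ linear_form l, (linprod C 0).@[root_pt l] != 0
  & (0 < N)%N -> (dia C 0).@[root_pt l] = 0].
Hypothesis low_last : forall i, (i < N)%N -> (minor_deg C i.+1 <= minor_deg C 0)%N ->
  last_occurrence i.

Lemma minor_last_vanishing i j : (i < N)%N -> last_occurrence i -> (j <= N)%N ->
  j != i.+1 -> (minor C j).@[root_pt (lin C i)] = 0.
Proof.
move=> lti li lej; rewrite neq_ltn ltnS mevalM => /orP [leji|ltij].
  have [q ->] := linprod_dvd C leji.
  rewrite (linprod_recl lti) !mevalM meval_root_pt ?mul0r ?mulr0 //.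
  by case: (lin_linear lti).
rewrite /diaprod (@big_cat_nat _ _ _ i.+1) //=; last exact: ltnW.
rewrite (big_ltn ltij) !mevalM dia_next ?mul0r ?mulr0 ?mul0r //.
exact: leq_trans ltij lej.
Qed.

Let sbM := minors_standard_basis C.
Let ncI := @minor_ideal_no_common_zero K C.

Lemma essential_minor0 : essential (minors C) (minor C 0).
Proof.
apply/(essentialP sbM (@ncI)); first exact: mem_minors.
case: dia_first => l [ll l0 dl]; exists l; split=> //.
  by rewrite /minor diaprod0 mul1r.
move=> _ /minorsP [[|j] lej ->]; first by rewrite eqxx.
rewrite /minor /diaprod big_ltn // !mevalM dl ?mul0r //.
exact: leq_trans lej.
Qed.

(** The minor of index i.+1 does not vanish at the zero of a last occurrence
    lin i, whereas those before are multiples of lin i and those after contain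
    dia i.+1, which vanishes there. Conversely, a point showing that a minor other
    than the first is essential is the zero of a last occurrence. *)
Lemma essential_minorS i : (i < N)%N ->
  essential (minors C) (minor C i.+1) <-> last_occurrence i.
Proof.
move=> lti; rewrite (essentialP sbM (@ncI)) ?mem_minors //; split=> [[l [ll il jl]]|li].
  have z0 : (linprod C 0).@[root_pt l] = 0.
    have -> : linprod C 0 = minor C 0 by rewrite /minor diaprod0 mul1r.
    apply: jl; first exact: mem_minors.
    by apply/eqP => /minor_inj => /(_ (leq0n _) lti).
  have [k [ltk lk same]] := root_of_linprod ll z0.
  suff -> : i = k by [].
  apply/eqP/negPn/negP => ik; move/negP: il; apply.
  have nk := minor_last_nonvanishing ltk lk.
  rewrite -(inj_eq succn_inj) in ik.
  by apply/eqP/(same _ _ (minor_homog lti)); apply: minor_last_vanishing.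
exists (lin C i); split; first exact: lin_linear.
  exact: minor_last_nonvanishing.
move=> _ /minorsP [j lej ->] ne; apply: minor_last_vanishing => //.
by apply: contraNneq ne => ->.
Qed.

(** An essential element of any standard basis is detected by a zero of some
    linear form; in degree above the initial one this zero belongs to the last
    occurrence of a superdiagonal entry, and comparing with the minors fixes the
    degree. *)
Lemma essential_detected B f : standard_basis I B -> f \in B -> essential B f ->
  (minor_deg C 0 < form_deg f)%N ->
  exists i, [/\ (i < N)%N, last_occurrence i, minor_deg C i.+1 = form_deg f,
    f.@[root_pt (lin C i)] != 0
    & forall g, g \in B -> g != f -> g.@[root_pt (lin C i)] = 0].
Proof.
move=> sB fB; rewrite (essentialP sB (@ncI)) // => -[l [ll fl gl]] ltd.
have hB g : g \in B -> exists e, g \is e.-homog by case: sB => + _ _; apply.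
have IB : I = generated [set f | f \in B] by case: sB.
have detect j P : (j <= N)%N -> (minor C j).@[P] != 0 ->
    exists2 b, b \in B & (form_deg b <= minor_deg C j)%N /\ b.@[P] != 0.
  move=> lej nz; have := minor_in_ideal lej; rewrite IB => Ij.
  have [b [e [bB hb le_e bP]]] := generated_nonvanishing hB Ij (minor_homog lej) nz.
  by exists b => //; rewrite (form_degE (standard_basis_neq0 sB bB) hb).
have z0 : (linprod C 0).@[root_pt l] = 0.
  apply/eqP/negPn/negP => nz; have [||b bB [le_b bl]] := @detect 0%N (root_pt l).
  - by [].
  - by rewrite /minor diaprod0 mul1r.
  have [Ebf|ne] := eqVneq b f; first by move: ltd; rewrite ltnNge -Ebf le_b.
  by rewrite gl ?eqxx in bl.
have [i [lti li same]] := root_of_linprod ll z0.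
have fi : f.@[root_pt (lin C i)] != 0.
  by apply: contraNneq fl => /(same _ _ (standard_basis_homog sB fB)) ->.
have gi g : g \in B -> g != f -> g.@[root_pt (lin C i)] = 0.
  by move=> gB gf; apply/(same _ _ (standard_basis_homog sB gB)); apply: gl.
exists i; split=> //; apply/eqP; rewrite eqn_leq; apply/andP; split; last first.
  have [b bB [le_b bl]] := detect _ _ lti (minor_last_nonvanishing lti li).
  have [<-//|ne] := eqVneq b f.
  by rewrite gi ?eqxx in bl.
have If := standard_basis_mem sB fB.
have [m [e [mM hm le_e mi]]] :=
  generated_nonvanishing (@minors_homog _ C) If (standard_basis_homog sB fB) fi.
case/minorsP: mM => j lej Em; have [Ej|ne] := eqVneq j i.+1.
  by rewrite -Ej; move: hm; rewrite Em minor_homogE // => /eqP ->.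
by rewrite Em minor_last_vanishing ?eqxx in mi.
Qed.

Lemma minor_not_last_vanishing i : (i < N)%N -> ~~ last_occurrence i ->
  (minor C i.+1).@[root_pt (lin C i)] = 0.
Proof.
move=> lti; rewrite /last_occurrence -has_predC => /hasP [j].
rewrite mem_iota subnKC // => /andP [ltij ltj] /negPn /eqP z.
rewrite mevalM; apply/eqP; rewrite mulf_eq0; apply/orP; right.
rewrite /linprod rmorph_prod /= prodf_seq_eq0; apply/hasP; exists j; rewrite ?mem_index_iota ?ltij //=.
by rewrite z eqxx.
Qed.

Definition last_in_degree (d : nat) : seq nat :=
  [seq i <- iota 0 N | last_occurrence i & minor_deg C i.+1 == d].

(** The last occurrence at which an element is detected determines that element,
    since all the others vanish there. *)
Lemma nb_essential_leq B d : standard_basis I B -> (minor_deg C 0 < d)%N ->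
  (nb_essential B d <= size (last_in_degree d))%N.
Proof.
move=> sB ltd; rewrite /nb_essential -size_filter; set E := filter _ _.
have EP f : f \in E -> [/\ f \in B, essential B f & form_deg f = d].
  by rewrite mem_filter => /andP [/andP [/asboolP ? /eqP ?] ?].
have /choice [s sP] (f : S) : exists i, f \in E -> i \in last_in_degree d /\
    (f.@[root_pt (lin C i)] != 0 /\
     forall g, g \in B -> g != f -> g.@[root_pt (lin C i)] = 0).
  have [/EP [fB ess Ed]|nE] := boolP (f \in E); last by exists 0%N.
  have [|i [lti li Ei fi gi]] := essential_detected sB fB ess; first by rewrite Ed.
  by exists i => _; rewrite mem_filter li Ei Ed eqxx mem_iota.
rewrite -(size_map s E); apply: uniq_leq_size.
  rewrite map_inj_in_uniq ?filter_uniq ?(standard_basis_uniq sB) // => f g fE gE Es.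
  have [_ [_ vf]] := sP f fE; have [_ [ng _]] := sP g gE.
  apply/eqP/negPn/negP => fg; have [gB _ _] := EP _ gE.
  by move/negP: ng; apply; rewrite -Es vf // eq_sym.
by move=> _ /mapP [f /sP [? _] ->].
Qed.

Lemma minors_cons : minors C = minor C 0 :: [seq minor C i.+1 | i <- iota 0 N].
Proof. by rewrite /minors /= (iotaDl 1 0 N) -map_comp. Qed.

Lemma form_deg_minor j : (j <= N)%N -> form_deg (minor C j) = minor_deg C j.
Proof. by move=> lej; apply: form_degE (minor_neq0 lej) (minor_homog lej). Qed.

Lemma nb_essential_minors d : (minor_deg C 0 < d)%N ->
  nb_essential (minors C) d = size (last_in_degree d).
Proof.
move=> ltd; rewrite /nb_essential {2}minors_cons /= form_deg_minor // [_ == d]ltn_eqF //.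
rewrite andbF add0n count_map size_filter; apply: eq_in_count => i.
rewrite mem_iota => lti /=; rewrite form_deg_minor //; congr (_ && _).
by apply/asboolP/idP => /(essential_minorS lti).
Qed.

Lemma nb_essential_above_minors :
  nb_essential_above (minors C) (minor_deg C 0) =
  size [seq i <- iota 0 N | last_occurrence i & (minor_deg C 0 < minor_deg C i.+1)%N].
Proof.
rewrite /nb_essential_above {2}minors_cons /= form_deg_minor // ltnn andbF add0n.
rewrite count_map size_filter; apply: eq_in_count => i.
rewrite mem_iota => lti /=; rewrite form_deg_minor //; congr (_ && _).
by apply/asboolP/idP => /(essential_minorS lti).
Qed.

Lemma essential_low j : (j <= N)%N -> (minor_deg C j <= minor_deg C 0)%N ->
  essential (minors C) (minor C j).
Proof.
case: j => [|i] lti low; first exact: essential_minor0.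
by apply/essential_minorS => //; apply: low_last.
Qed.

Lemma nb_essential_leq_size B d : standard_basis I B ->
  (nb_essential B d <= size [seq f <- B | f \is d.-homog])%N.
Proof.
move=> sB; rewrite size_filter; apply: sub_in_count => f fB /= /andP [_].
by rewrite (form_deg_homog sB).
Qed.

(** Above the initial degree this is the bound by last occurrences; up to it all
    the minors are essential, and no standard basis has more elements there. *)
Lemma minors_e_maximal : e_maximal I (minors C).
Proof.
split=> // d; split=> [|B sB]; first by exists (minors C).
case: (ltnP (minor_deg C 0) d) => [ltd|led].
  by rewrite nb_essential_minors //; apply: nb_essential_leq.
apply: leq_trans (nb_essential_leq_size _ sB) _.
apply: leq_trans (standard_basis_leq_size d sB sbM) _.
rewrite size_filter; apply: sub_in_count => f fM /=.
case/minorsP: (fM) => j lej ->; rewrite minor_homogE // => /eqP Ed.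
rewrite form_deg_minor // Ed eqxx andbT; apply/asboolP/essential_low => //.
by rewrite Ed.
Qed.

Lemma e_maximal_nb B d : e_maximal I B -> nb_essential B d = nb_essential (minors C) d.
Proof.
case=> sB /(_ d) [_ maxB]; have [_ /(_ d) [_ maxM]] := minors_e_maximal.
by apply/eqP; rewrite eqn_leq maxM // maxB.
Qed.

Lemma alpha_minors a : is_alpha I a -> a = minor_deg C 0.
Proof.
case=> B sB [[f fB Ea] amin].
have hB g : g \in B -> exists e, g \is e.-homog by case: sB => + _ _; apply.
apply/eqP; rewrite eqn_leq; apply/andP; split; last first.
  have hf := standard_basis_homog sB fB; rewrite Ea in hf.
  rewrite leqNgt; apply/negP => /minor_ideal_low => /(_ _ (standard_basis_mem sB fB) hf) /eqP.
  by rewrite (negPf (standard_basis_neq0 sB fB)).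
case: dia_first => l [ll l0 _].
have Ij := minor_in_ideal (leq0n N); have EB : I = generated [set f | f \in B] by case: sB.
rewrite EB in Ij; have := minor_homog (leq0n N).
have nz : (minor C 0).@[root_pt l] != 0 by rewrite /minor diaprod0 mul1r.
move=> h0; have [b [e [bB hb le_e _]]] := generated_nonvanishing hB Ij h0 nz.
by apply: leq_trans (amin b bB) _; rewrite (form_degE (standard_basis_neq0 sB bB) hb).
Qed.

(** The elements of degree d are as many as the minors of degree d, while the
    essential ones are at most as many as the last occurrences. *)
Lemma last_of_all_essential B : standard_basis I B ->
  (forall f, f \in B -> essential B f) -> forall i, (i < N)%N -> last_occurrence i.
Proof.
move=> sB essB i lti; apply/negPn/negP => nli.
set d := minor_deg C i.+1.
have ltd : (minor_deg C 0 < d)%N by rewrite ltnNge; apply: contra nli; apply: low_last.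
have := nb_essential_leq sB ltd; rewrite leqNgt => /negP; apply.
have -> : nb_essential B d = size [seq f <- B | f \is d.-homog].
  rewrite size_filter; apply: eq_in_count => f fB /=.
  by rewrite (form_deg_homog sB) // (introT (asboolP _) (essB f fB)).
apply: leq_trans (standard_basis_leq_size d sbM sB).
rewrite minors_filter size_map /= [minor_deg C 0 == d]ltn_eqF //.
rewrite (iotaDl 1 0 N) filter_map size_map.
apply: (@uniq_leq_size _ (i :: last_in_degree d)) => [|j].
  by rewrite /= filter_uniq ?iota_uniq // mem_filter (negPf nli).
rewrite inE !mem_filter => /predU1P [->|/andP [/andP [_ /eqP Ej] jN]] /=.
  by rewrite eqxx mem_iota.
by rewrite /= add1n Ej eqxx.
Qed.

End ChainEssential.

(** * The sequence of linear factors *)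

Section Labels.
Context {K : closedFieldType}.
Local Notation S := {mpoly K[2]}.
Variable D : representation K.
Local Notation r := (rank D).

(** The labels with first component in ks, so that the labels can be cut at the
    end of a block. *)
Definition labels_of (ks : seq nat) : seq (nat * nat * nat) :=
  [seq (p, j) | p <- [seq (k, i) | k <- ks, i <- iota 1 (v_ D k)],
                j <- iota 1 (mu_ D p.1 p.2)].

Lemma labels_of_cat ks ks' : labels_of (ks ++ ks') = labels_of ks ++ labels_of ks'.
Proof. by rewrite /labels_of !allpairs_cat. Qed.

Lemma mem_labels_of ks k i j : ((k, i, j) \in labels_of ks) =
  [&& k \in ks, 1 <= i <= v_ D k & 1 <= j <= mu_ D k i]%N.
Proof.
apply/allpairsPdep/and3P => [[p [j' [/allpairsPdep [k' [i' [kk ii ->]]] jj [-> -> ->]]]]|].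
  by move: ii jj; rewrite !mem_iota !add1n !ltnS.
case=> kk ii jj; exists (k, i), j; rewrite mem_iota add1n ltnS; split=> //.
by apply/allpairsPdep; exists k, i; rewrite mem_iota add1n ltnS.
Qed.

Lemma prod_labels_of ks :
  \prod_(p <- labels_of ks) H_ D p.1.1 p.1.2 = \prod_(k <- ks) Phi D k.
Proof.
rewrite /labels_of big_allpairs_dep big_allpairs_dep /=; apply: eq_bigr => k _.
rewrite /Phi /index_iota subn1 /=; apply: eq_bigr => i _.
by rewrite big_const_seq count_predT size_iota iter_mulr_1.
Qed.

Lemma size_labels_of ks : size (labels_of ks) = (\sum_(k <- ks) delta D k)%N.
Proof.
rewrite /labels_of size_allpairs_dep sumnE big_map big_allpairs_dep /=; apply: eq_bigr => k _.
rewrite /delta /index_iota subn1 /=; apply: eq_bigr => i _.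
by rewrite size_iota.
Qed.

Lemma labels_split k : (k <= r)%N ->
  labels D = labels_of (iota 1 k) ++ labels_of (iota k.+1 (r - k)).
Proof. by move=> lek; rewrite -labels_of_cat -add1n -iotaD subnKC. Qed.

Lemma size_labels_iota k : size (labels_of (iota 1 k)) = Delta D k.
Proof. by rewrite size_labels_of /Delta /index_iota subn1. Qed.

Lemma size_labels : size (labels D) = Delta D r.
Proof. exact: size_labels_iota. Qed.

Lemma PhiTail_labels k : (k <= r)%N ->
  PhiTail D k = \prod_(p <- drop (Delta D k) (labels D)) H_ D p.1.1 p.1.2.
Proof.
move=> lek; rewrite (labels_split lek) drop_size_cat ?size_labels_iota //.
by rewrite prod_labels_of /PhiTail /index_iota subSS.
Qed.

Definition label (s : nat) : nat * nat * nat := nth (0, 0, 0)%N (labels D) s.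
Definition label_form (s : nat) : S := H_ D (label s).1.1 (label s).1.2.

Lemma labelP s : (s < Delta D r)%N -> [&& 1 <= (label s).1.1 <= r,
  1 <= (label s).1.2 <= v_ D (label s).1.1
  & 1 <= (label s).2 <= mu_ D (label s).1.1 (label s).1.2]%N.
Proof.
move=> lts; have : label s \in labels D by rewrite mem_nth ?size_labels.
case: (label s) => [[k i] j]; rewrite [labels D]/(labels_of (iota 1 r)) mem_labels_of.
by rewrite mem_iota add1n ltnS.
Qed.

Lemma label_block_leq k s : (k <= r)%N -> (s < Delta D r)%N ->
  ((label s).1.1 <= k)%N = (s < Delta D k)%N.
Proof.
move=> lek lts; rewrite /label (labels_split lek) nth_cat size_labels_iota.
case: ltnP => [ltk|gek].
  have : nth (0, 0, 0)%N (labels_of (iota 1 k)) s \in labels_of (iota 1 k).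
    by rewrite mem_nth ?size_labels_iota.
  case: (nth _ _ _) => [[k' i] j]; rewrite mem_labels_of mem_iota add1n ltnS.
  by case/and3P => /andP [_ ->].
have : nth (0, 0, 0)%N (labels_of (iota k.+1 (r - k))) (s - Delta D k)
    \in labels_of (iota k.+1 (r - k)).
  rewrite mem_nth // -(ltn_add2l (Delta D k)) subnKC //.
  by rewrite -size_labels_iota -size_cat -labels_split // size_labels.
case: (nth _ _ _) => [[k' i] j]; rewrite mem_labels_of mem_iota.
by case/and3P => /andP [ltk _] _ _ /=; rewrite leqNgt ltk.
Qed.

Lemma label_block_homo s s' : (s <= s')%N -> (s' < Delta D r)%N ->
  ((label s).1.1 <= (label s').1.1)%N.
Proof.
move=> les lts'; have lts := leq_ltn_trans les lts'.
have /and3P [/andP [_ ler] _ _] := labelP lts'.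
rewrite (label_block_leq ler lts); apply: leq_ltn_trans les _.
by rewrite -(label_block_leq ler lts').
Qed.

Lemma DeltaS k : Delta D k.+1 = (Delta D k + delta D k.+1)%N.
Proof. by rewrite /Delta big_nat_recr. Qed.

Lemma delta_gt0 k : (1 <= k <= r)%N -> (0 < delta D k)%N.
Proof.
move=> kr; rewrite /delta big_ltn ?ltnS ?v_gt0 // addn_gt0 mu_gt0 //.
exact: v_gt0.
Qed.

Lemma Delta_homo k k' : (k <= k')%N -> (Delta D k <= Delta D k')%N.
Proof.
elim: k' => [|k' IH]; first by rewrite leqn0 => /eqP ->.
rewrite leq_eqVlt => /predU1P [->//|]; rewrite ltnS => /IH le; apply: leq_trans le _.
by rewrite DeltaS leq_addr.
Qed.

Lemma alphaS k : (k < r)%N -> alpha D k.+1 = (alpha D k + t_ D k.+1)%N.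
Proof.
move=> ltk; have := Delta_homo ltk; rewrite /alpha /beta big_nat_recr //= DeltaS => le.
have E : (Delta D r - Delta D k = delta D k.+1 + (Delta D r - (Delta D k + delta D k.+1)))%N.
  by rewrite subnDA subnKC // leq_subRL ?Delta_homo // ltnW.
by rewrite E; lia.
Qed.

Lemma alpha_lt k k' : (k < k' <= r)%N -> (alpha D k < alpha D k')%N.
Proof.
case/andP; elim: k' => // k' IH; rewrite ltnS leq_eqVlt => /predU1P [->|ltk] lek'.
  by rewrite alphaS // -addn1 leq_add2l t_gt0.
apply: ltn_trans (IH ltk (ltnW lek')) _.
by rewrite alphaS // -addn1 leq_add2l t_gt0.
Qed.

Lemma alpha_inj k k' : (k <= r)%N -> (k' <= r)%N -> alpha D k = alpha D k' -> k = k'.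
Proof.
move=> lek lek' E; case: (ltngtP k k') => // ltk.
  by have := @alpha_lt k k'; rewrite ltk lek' E ltnn => /(_ isT).
by have := @alpha_lt k' k; rewrite ltk lek E ltnn => /(_ isT).
Qed.

Lemma block_endP s : (s.+1 < Delta D r)%N ->
  match block_end D s.+1 with
  | Some k => [/\ (1 <= k < r)%N, (label s).1.1 = k & (label s.+1).1.1 = k.+1]
  | None => (label s.+1).1.1 = (label s).1.1
  end.
Proof.
move=> lts; have lts' := ltnW lts.
case E : (block_end D s.+1) => [k|].
  have : k \in [seq k <- iota 1 r.-1 | Delta D k == s.+1].
    by move: E; rewrite /block_end; case: [seq _ <- _ | _] => //= x y [->]; rewrite mem_head.
  rewrite mem_filter mem_iota => /andP [/eqP Ek /andP [k_gt0 ltk]].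
  have {}ltk : (k < r)%N by move: ltk; rewrite add1n; case: (r) => //=; rewrite ltn0 ltnNge k_gt0.
  split; first by rewrite k_gt0.
    apply/eqP; rewrite eqn_leq (label_block_leq (ltnW ltk) lts') Ek leqnn /=.
    rewrite -(prednK k_gt0) ltnNge (label_block_leq _ lts'); last by rewrite (leq_trans (leq_pred _)) // ltnW.
    rewrite -leqNgt -ltnS -Ek -{2}(prednK k_gt0) DeltaS -addn1 leq_add2l prednK // delta_gt0 //.
    by rewrite k_gt0 ltnW.
  apply/eqP; rewrite eqn_leq (label_block_leq ltk lts) DeltaS Ek -addn1 leq_add2l delta_gt0 //=.
  by rewrite ltnNge (label_block_leq (ltnW ltk) lts) Ek ltnn.
have /and3P [/andP [k_gt0 ler] _ _] := labelP lts'.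
apply/eqP; rewrite eqn_leq (label_block_homo (leqnSn s) lts) andbT.
rewrite (label_block_leq ler lts) ltnNge; apply/negP => le.
have lt : (s < Delta D (label s).1.1)%N by rewrite -(label_block_leq ler lts').
have Ek : Delta D (label s).1.1 = s.+1 by apply/eqP; rewrite eqn_leq le lt.
have : (label s).1.1 \in [seq k <- iota 1 r.-1 | Delta D k == s.+1].
  rewrite mem_filter Ek eqxx mem_iota k_gt0 /= add1n.
  have ltr : ((label s).1.1 < r)%N.
    by rewrite ltn_neqAle ler andbT; apply: contraTneq lts => <-; rewrite Ek ltnn.
  by rewrite prednK // (leq_ltn_trans _ ltr).
by move: E; rewrite /block_end; case: [seq _ <- _ | _].
Qed.

Lemma labels_index_lt ps (mu : nat * nat -> nat) p j j' :
  (1 <= j < j')%N -> (j' <= mu p)%N -> p \in ps ->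
  (index (p, j) [seq (p, j) | p <- ps, j <- iota 1 (mu p)] <
   index (p, j') [seq (p, j) | p <- ps, j <- iota 1 (mu p)])%N.
Proof.
case/andP => j1 ltj lej'; elim: ps => //= q ps IH.
rewrite inE !index_cat; have [<- _|qp /= /IH] := eqVneq p q.
  have inj : injective (fun j : nat => (p, j)) by move=> x y [].
  rewrite !(mem_map inj) !mem_iota add1n !ltnS j1 lej' (leq_trans (ltnW ltj) lej').
  rewrite (leq_trans j1 (ltnW ltj)) /= !index_map //.
  have idx x : (1 <= x <= mu p)%N -> index x (iota 1 (mu p)) = x.-1.
    case: x => // x /= ltx; rewrite -{1}[x.+1](nth_iota 0 1 ltx) index_uniq ?iota_uniq //.
    by rewrite size_iota.
  rewrite !idx; first by case: (j) (j') j1 ltj => [|x] [|y].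
    by rewrite (leq_trans j1 (ltnW ltj)).
  by rewrite j1 (leq_trans (ltnW ltj)).
have nin x : ((p, x) \in [seq (q, j) | j <- iota 1 (mu q)]) = false.
  by apply/negP => /mapP [y _ [E _]]; rewrite E eqxx in qp.
by rewrite !nin ltn_add2l.
Qed.

End Labels.

(** * The canonical matrix *)

(** The determinant obtained by deleting column j. While j > 0 the first column
    has a single nonzero entry, along which the determinant is expanded; for
    j = 0 the matrix is triangular. *)
Lemma det_bidiagonal (R : comNzRingType) n (a b : nat -> R) j : (j <= n)%N ->
  \det (\matrix_(i < n, k < n) if bump j k == i then a i
        else if bump j k == i.+1 then b i else 0)
  = \prod_(0 <= i < j) a i * \prod_(j <= i < n) b i.
Proof.
elim: n a b j => [|n IH] a b j.
  by rewrite leqn0 => /eqP ->; rewrite det_mx00 !big_geq // mulr1.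
case: j => [_|j].
  have bump0 k : bump 0 k = k.+1 by [].
  rewrite big_geq // mul1r det_trig; last first.
    apply/is_trig_mxP => i k ltik; rewrite mxE bump0 eqSS.
    by rewrite [k == i :> nat]gtn_eqF // gtn_eqF // ltnS ltnW.
  by rewrite big_mkord; apply: eq_bigr => i _; rewrite mxE bump0 eqxx gtn_eqF.
rewrite ltnS => lej; rewrite (expand_det_col _ ord0) (bigD1 ord0) //= big1 ?addr0; last first.
  move=> i i0; rewrite mxE /bump /= [0%N == i]eq_sym.
  have /negPf -> : (i : nat) != 0%N by [].
  by rewrite mul0r.
rewrite mxE /= big_ltn // big_add1 /= -mulrA; congr (_ * _).
rewrite big_add1 /= -(IH (fun i => a i.+1) (fun i => b i.+1)) //.
rewrite /cofactor addn0 expr0 mul1r; congr (\det _); apply/matrixP => i k.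
by rewrite !mxE /= bumpS !eqSS.
Qed.

Section CanonicalChain.
Context {K : closedFieldType}.
Local Notation S := {mpoly K[2]}.
Variables (D : representation K) (U : S) (L : nat -> S).
Hypothesis UL : admissible D U L.
Local Notation r := (rank D).
Local Notation b0 := (beta0 D).
Local Notation n := (Delta D r).

Definition diag_entry (i : nat) : S :=
  if (i < b0)%N then L i
  else if i == b0 then L b0 * U ^+ t_ D 1 else Asubdiag D U (i - b0.+1).

Definition superdiag_entry (i : nat) : S :=
  if (i < b0)%N then - L i.+1 else (Adiag D)`_(i - b0).

Lemma canonical_matrixE (i : 'I_(b0 + n)) (j : 'I_(b0 + n).+1) :
  canonical_matrix D U L i j = if j == i :> nat then diag_entry i
    else if j == i.+1 :> nat then superdiag_entry i else 0.
Proof.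
have [i' Ei] : exists i' : 'I_b0 + 'I_n, unsplit i' = i by exists (split i); apply: splitK.
have [j' Ej] : exists j' : 'I_b0.+1 + 'I_n, unsplit j' = j.
  by exists (split (j : 'I_(b0.+1 + n))); apply: splitK.
have Mij : canonical_matrix D U L i j =
    block_mx (Bblock D L) 0 (Cblock D U L) (Ablock D U) (unsplit i') (unsplit j').
  by rewrite Ei Ej.
rewrite Mij -Ei -Ej /diag_entry /superdiag_entry {Mij Ei Ej i j}.
case: i' => i; case: j' => j /=; move: (ltn_ord i) (ltn_ord j) => lti ltj.
- by rewrite block_mxEul mxE lti.
- by rewrite block_mxEur mxE lti; do ?case: eqP => //; lia.
- rewrite block_mxEdl mxE ltnNge leq_addr /=.
  by do ?[case: eqP => //= ?]; lia.
- rewrite block_mxEdr mxE ltnNge leq_addr /= addKn -val_eqE /=.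
  have -> : (b0.+1 + j == b0 + i)%N = (i == j.+1 :> nat) by apply/eqP/eqP; lia.
  have -> : (b0.+1 + j == (b0 + i).+1)%N = (i == j :> nat) by apply/eqP/eqP; lia.
  case: eqP => [->|ij]; first by rewrite ltn_eqF.
  case: eqP => // Eij; have -> : (b0 + i == b0)%N = false by apply/eqP; lia.
  by congr Asubdiag; lia.
Qed.

Lemma canonical_basisE : canonical_basis D U L =
  [seq \prod_(0 <= i < j) - diag_entry i * \prod_(j <= i < b0 + n) superdiag_entry i
     | j <- iota 0 (b0 + n).+1].
Proof.
rewrite -val_enum_ord -map_comp; apply: eq_map => j /=.
under eq_bigr do rewrite -mulN1r; rewrite big_split /= prodr_const_nat subn0 -mulrA.
rewrite -det_bidiagonal; last by rewrite -ltnS.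
congr (_ * \det _); apply/matrixP => i k.
by rewrite mxE canonical_matrixE [RHS]mxE.
Qed.



Local Notation dg := diag_entry.
Local Notation sp := superdiag_entry.
Local Notation h := (label_form D).

Lemma label_linear s : (s < n)%N -> linear_form (h s).
Proof. by move=> /labelP /and3P [k i _]; apply: H_linear. Qed.

Lemma label_form_eq_or_indep s s' : (s < n)%N -> (s' < n)%N ->
  h s = h s' \/ lin_indep (h s) (h s').
Proof.
by move=> /labelP /and3P [k i _] /labelP /and3P [k' i' _]; apply: H_normalized.
Qed.

Lemma U_linear : linear_form U. Proof. by case: UL => [[]]. Qed.

Lemma L_linear j : (j <= b0)%N -> linear_form (L j).
Proof. by case: UL => [[_ lL] _ _ _]; apply: lL. Qed.

Lemma L_indep i j : (i <= b0)%N -> (j <= b0)%N -> i != j -> lin_indep (L i) (L j).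
Proof.
case: UL => _ _ indL _ lei lej; rewrite neq_ltn => /orP [] lt.
  by apply: indL; rewrite lt.
by apply/lin_indep_sym/indL; rewrite lt.
Qed.

Lemma U_L_indep j : (j <= b0)%N -> lin_indep U (L j).
Proof. by case: UL => _ indU _ _; apply: indU. Qed.

Lemma U_label_indep s : (s < n)%N -> lin_indep U (h s).
Proof. by case: UL => _ _ _ indH /labelP /and3P [k i _]; case: (indH _ _ k i). Qed.

Lemma L_label_indep s j : (s < n)%N -> (j <= b0)%N -> lin_indep (L j) (h s).
Proof. by case: UL => _ _ _ indH /labelP /and3P [k i _]; case: (indH _ _ k i) => _; apply. Qed.

Lemma Adiag_label s : (s < n)%N -> (Adiag D)`_s = - h s.
Proof. by move=> lts; rewrite (nth_map (0, 0, 0)%N) ?size_labels. Qed.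

Lemma superdiag_left i : (i < b0)%N -> sp i = - L i.+1.
Proof. by rewrite /superdiag_entry => ->. Qed.

Lemma superdiag_right s : (s < n)%N -> sp (b0 + s) = - h s.
Proof. by move=> lts; rewrite /superdiag_entry ltnNge leq_addr addKn Adiag_label. Qed.

Lemma superdiag_linear i : (i < b0 + n)%N -> linear_form (sp i).
Proof.
case: (ltnP i b0) => [lti _|lei]; first by rewrite superdiag_left //; apply/linear_formN/L_linear.
rewrite -(subnKC lei) ltn_add2l => lts; rewrite superdiag_right //.
exact/linear_formN/label_linear.
Qed.

Definition repeated (s : nat) : bool := (Adiag D)`_s \in drop s.+1 (Adiag D).

Lemma repeatedP s : (s < n)%N ->
  reflect (exists2 s', (s < s' < n)%N & h s' = h s) (repeated s).
Proof.
move=> lts; have sA : size (Adiag D) = n by rewrite size_map size_labels.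
apply: (iffP (nthP 0)) => [[i]|[s' /andP [lt1 lt2] E]].
  rewrite size_drop sA nth_drop => lti; have lt2 : (s.+1 + i < n)%N by rewrite -ltn_subRL.
  rewrite !Adiag_label // => /oppr_inj E; exists (s.+1 + i)%N => //.
  by rewrite lt2 andbT ltn_addr.
exists (s' - s.+1)%N; first by rewrite size_drop sA ltn_sub2r // (leq_ltn_trans lt1).
by rewrite nth_drop subnKC // !Adiag_label // E.
Qed.

(** The exponent of U that the start of a new block at position s brings in. *)
Definition jump (s : nat) : nat := if block_end D s is Some k then t_ D k.+1 else 0.

Lemma diag_right s : dg (b0 + s.+1) = Asubdiag D U s.
Proof.
rewrite /diag_entry ltnNge leq_addr /= -{2}[b0]addn0 eqn_add2l /=.
by congr Asubdiag; lia.
Qed.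

(** The entries below the diagonal of the lower right block are, up to sign,
    h s times a power of U, with one more power of U in place of h s if this
    linear form occurs again further down the diagonal. *)
Lemma Asubdiag_repeated s : repeated s -> exists2 c : K, c != 0 &
  Asubdiag D U s = c *: U ^+ (jump s.+1).+1.
Proof.
rewrite /repeated /Asubdiag /jump => ->; case: (block_end D s.+1) => [k|].
  by exists 1; rewrite ?oner_eq0 ?scale1r.
by exists (-1); rewrite ?oppr_eq0 ?oner_eq0 // expr1 scaleN1r.
Qed.

Lemma Asubdiag_last s : (s < n)%N -> ~~ repeated s ->
  Asubdiag D U s = h s * U ^+ jump s.+1.
Proof.
move=> lts; rewrite /repeated /Asubdiag /jump => /negPf ->.
rewrite Adiag_label // opprK; case: (block_end D s.+1) => [k|] //.
by rewrite expr0 mulr1.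
Qed.

Definition entry_deg (i : nat) : nat :=
  if (i < b0)%N then 1
  else if i == b0 then (t_ D 1).+1
  else (jump (i - b0)).+1.

Lemma diag_homog i : (i < b0 + n)%N -> - dg i \is (entry_deg i).-homog.
Proof.
have [hU _] := U_linear; have hUt e : U ^+ e \is e.-homog.
  by have := dhomogMn e hU; rewrite mul1n.
have hfU e (f : S) : f \is 1.-homog -> f * U ^+ e \is e.+1.-homog.
  by move=> hf; apply: (dhomogM hf (hUt e)).
rewrite dhomogN /entry_deg; case: (ltngtP i b0) => [lti _|lti|->].
- by rewrite /diag_entry lti; case: (L_linear (ltnW lti)).
- have Ei : i = (b0 + (i - b0.+1).+1)%N by lia.
  have Ej : (i - b0 = (i - b0.+1).+1)%N by lia.
  rewrite {1 2}Ei diag_right Ej ltn_add2l => lts.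
  case: (boolP (repeated (i - b0.+1))) => [/Asubdiag_repeated [c _ ->]|nrep].
    exact: dhomogZ.
  rewrite (Asubdiag_last (ltnW lts) nrep); apply: hfU.
  by case: (label_linear (ltnW lts)).
- move=> _; rewrite /diag_entry ltnn eqxx; apply: hfU.
  by case: (L_linear (leqnn b0)).
Qed.

Lemma entry_deg_gt0 i : (i < b0 + n)%N -> (0 < entry_deg i)%N.
Proof. by move=> _; rewrite /entry_deg; case: ifP => // _; case: ifP. Qed.

Lemma meval_expn_neq0 (f : S) (P : 'I_2 -> K) e : f.@[P] != 0 -> (f ^+ e).@[P] != 0.
Proof. by move=> nz; rewrite rmorphXn /= expf_neq0. Qed.

Lemma L_superdiag i j : (i <= b0)%N -> (i <= j < b0 + n)%N -> (L i).@[root_pt (sp j)] != 0.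
Proof.
move=> lei /andP [leij]; case: (ltnP j b0) => [ltj _|lej].
  rewrite superdiag_left //; apply: lin_indep_nonvanishingN; try exact: L_linear.
  by apply: L_indep => //; rewrite gtn_eqF.
rewrite -(subnKC lej) ltn_add2l => lts; rewrite superdiag_right //.
apply: lin_indep_nonvanishingN; [exact: label_linear | exact: L_linear |].
exact/lin_indep_sym/L_label_indep.
Qed.

Lemma U_superdiag j : (j < b0 + n)%N -> U.@[root_pt (sp j)] != 0.
Proof.
case: (ltnP j b0) => [ltj _|lej].
  rewrite superdiag_left //; apply: lin_indep_nonvanishingN; try exact: L_linear; try exact: U_linear.
  exact/lin_indep_sym/U_L_indep.
rewrite -(subnKC lej) ltn_add2l => lts; rewrite superdiag_right //.
apply: lin_indep_nonvanishingN; [exact: label_linear | exact: U_linear |].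
exact/lin_indep_sym/U_label_indep.
Qed.

Lemma diag_nonvanishing i j : (i <= j < b0 + n)%N -> (- dg i).@[root_pt (sp j)] != 0.
Proof.
move=> ij; have /andP [leij ltj] := ij; rewrite mevalN oppr_eq0.
have Unz e := meval_expn_neq0 e (U_superdiag ltj).
case: (ltngtP i b0) => [lti|lti|Ei].
- by rewrite /diag_entry lti L_superdiag // ltnW.
- have Ei : i = (b0 + (i - b0.+1).+1)%N by lia.
  have lts : ((i - b0.+1).+1 < n)%N by lia.
  rewrite {1}Ei diag_right.
  case: (boolP (repeated (i - b0.+1))) => [/Asubdiag_repeated [c c0 ->]|nrep].
    by rewrite mevalZ mulf_neq0.
  rewrite (Asubdiag_last (ltnW lts) nrep) mevalM mulf_neq0 //.
  have lts' : (j - b0 < n)%N by lia.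
  have -> : j = (b0 + (j - b0))%N by lia.
  rewrite superdiag_right //; apply: lin_indep_nonvanishingN; try by apply: label_linear; lia.
  case: (label_form_eq_or_indep lts' (ltnW lts)) => // E.
  by case/(repeatedP (ltnW lts)): nrep; exists (j - b0)%N => //; lia.
- move: ij; rewrite Ei => ij; rewrite /diag_entry ltnn eqxx mevalM mulf_neq0 //.
  exact: L_superdiag.
Qed.

Definition canonical_chain : chain K :=
  @Chain K (b0 + n) sp (fun i => - dg i) entry_deg
    superdiag_linear diag_homog entry_deg_gt0 diag_nonvanishing.

Local Notation C := canonical_chain.

Lemma canonical_basis_minors : canonical_basis D U L = minors C.
Proof. exact: canonical_basisE. Qed.

Lemma last_occurrence_left i : (i < b0)%N -> last_occurrence C i.
Proof.
move=> lti; apply/last_occurrenceP => j /andP [ltij /= ltj].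
rewrite superdiag_left //; case: (ltnP j b0) => [ltjb|lej].
  rewrite superdiag_left // mevalN oppr_eq0; apply: lin_indep_nonvanishingN; try exact: L_linear.
  by apply: L_indep; rewrite // ltn_eqF // ltnS.
move: ltj; rewrite -(subnKC lej) ltn_add2l => lts; rewrite superdiag_right // mevalN oppr_eq0.
by apply: lin_indep_nonvanishingN; try exact: L_linear; try exact: label_linear; apply: L_label_indep.
Qed.

Lemma last_occurrence_right s : (s < n)%N -> last_occurrence C (b0 + s) = ~~ repeated s.
Proof.
move=> lts; apply/last_occurrenceP/negP => [nz /(repeatedP lts) [s' /andP [lt1 lt2] E]|nrep j].
  have := nz (b0 + s')%N; rewrite /= !ltn_add2l lt1 lt2 !superdiag_right // E.
  move=> /(_ isT); rewrite meval_root_pt ?eqxx //.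
  by case: (linear_formN (label_linear lts)).
case/andP => ltij /= ltj; have Ej : j = (b0 + (j - b0))%N by lia.
have lts' : (j - b0 < n)%N by lia.
rewrite Ej !superdiag_right // mevalN oppr_eq0.
apply: lin_indep_nonvanishingN; try exact: label_linear.
case: (label_form_eq_or_indep lts lts') => // E; case: nrep.
by apply/(repeatedP lts); exists (j - b0)%N => //; lia.
Qed.

Lemma canonical_dia_next i : (i.+1 < len C)%N -> last_occurrence C i ->
  (dia C i.+1).@[root_pt (lin C i)] = 0.
Proof.
move=> /= lti li; rewrite mevalN; apply/eqP; rewrite oppr_eq0; apply/eqP.
case: (ltnP i b0) => [ltib|leb].
  rewrite superdiag_left //; have [hL _] := linear_formN (L_linear ltib).
  have L0 : (L i.+1).@[root_pt (- L i.+1)] = 0.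
    by apply/eqP; rewrite -oppr_eq0 -mevalN meval_root_pt.
  rewrite /diag_entry; case: (ltnP i.+1 b0) => // le; have -> : b0 = i.+1 by lia.
  by rewrite eqxx mevalM L0 mul0r.
have [s Ei] : exists s, i = (b0 + s)%N by exists (i - b0)%N; rewrite subnKC.
move: lti li; rewrite {i leb}Ei -addnS ltn_add2l => lts.
rewrite last_occurrence_right ?superdiag_right ?(ltnW lts) // => nrep.
rewrite diag_right (Asubdiag_last (ltnW lts) nrep) mevalM.
have [hl _] := linear_formN (label_linear (ltnW lts)).
suff -> : (h s).@[root_pt (- h s)] = 0 by rewrite mul0r.
by apply/eqP; rewrite -oppr_eq0 -mevalN meval_root_pt.
Qed.

Lemma canonical_dia_first : exists l, [/\ linear_form l, (linprod C 0).@[root_pt l] != 0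
  & (0 < len C)%N -> (dia C 0).@[root_pt l] = 0].
Proof.
have lL := L_linear (leq0n b0); exists (L 0%N); split=> //.
  rewrite /linprod rmorph_prod /= prodf_seq_neq0; apply/allP => j.
  rewrite mem_index_iota /= => ltj; case: (ltnP j b0) => [ltjb|lej].
    rewrite superdiag_left // mevalN oppr_eq0.
    by apply: lin_indep_nonvanishing; try exact: L_linear; apply: L_indep.
  have lts : (j - b0 < n)%N by lia.
  rewrite -(subnKC lej) superdiag_right // mevalN oppr_eq0.
  by apply: lin_indep_nonvanishing; try exact: L_linear; try exact: label_linear; apply: L_label_indep.
move=> _ /=; apply/eqP; rewrite mevalN oppr_eq0 /diag_entry.
have [hL _] := lL; case: ltnP => [_|]; first by rewrite meval_root_pt.
by rewrite leqn0 => /eqP E; rewrite E eqxx mevalM meval_root_pt ?mul0r.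
Qed.

Lemma minor_deg_left j : (j <= b0)%N -> minor_deg C j = (b0 + n)%N.
Proof.
move=> lej; rewrite /minor_deg /diaprod_deg /= big_nat (eq_bigr (fun=> 1%N)) => [|i /andP [_ lti]].
  by rewrite -big_nat sum_nat_const_nat subn0 muln1 subnKC // (leq_trans lej) ?leq_addr.
by rewrite /= /entry_deg (leq_trans lti lej).
Qed.

Lemma alpha0 : alpha D 0 = (b0 + n)%N.
Proof. by rewrite /alpha /beta [Delta D 0]/Delta !big_geq // addn0 subn0. Qed.

Lemma minor_deg_right s : (s < n)%N -> minor_deg C (b0 + s).+1 = alpha D (label D s).1.1.
Proof.
elim: s => [|s IH] lts.
  rewrite addn0; have /and3P [/andP [k1 kr] _ _] := labelP lts.
  have r_gt0 := leq_trans k1 kr.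
  have -> : (label D 0).1.1 = 1%N.
    apply/eqP; rewrite eqn_leq k1 andbT (label_block_leq r_gt0 lts) DeltaS.
    by rewrite addn_gt0 delta_gt0 ?orbT // r_gt0.
  have ltb : (b0 < len C)%N by rewrite /= -[X in (X < _)%N]addn0 ltn_add2l.
  have := minor_degS ltb; rewrite /= [minor_deg C b0]minor_deg_left //.
  by rewrite alphaS // alpha0 /entry_deg ltnn eqxx addnS => -[->].
have {}IH := IH (ltnW lts).
have ltb : ((b0 + s).+1 < len C)%N by rewrite /= -addnS ltn_add2l.
have Ed : entry_deg (b0 + s).+1 = (jump s.+1).+1.
  rewrite /entry_deg -addnS ltnNge leq_addr /= addKn ifN_eq //.
  by rewrite -[X in _ != X]addn0 eqn_add2l.
have := block_endP lts; rewrite addnS; have := minor_degS ltb; rewrite /= Ed IH /jump.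
case: (block_end D s.+1) => [k|]; rewrite addnS => -[->]; last by rewrite addn0 => ->.
by case=> [/andP [_ ltk] -> ->]; rewrite alphaS.
Qed.

Lemma canonical_low_last i : (i < len C)%N -> (minor_deg C i.+1 <= minor_deg C 0)%N ->
  last_occurrence C i.
Proof.
move=> /= lti; case: (ltnP i b0) => [/last_occurrence_left //|lei].
have lts : (i - b0 < n)%N by lia.
rewrite -{1}(subnKC lei) minor_deg_right // minor_deg_left // -alpha0 leqNgt alpha_lt //.
by have /and3P [] := labelP lts.
Qed.

End CanonicalChain.

(** * The represented ideal and its linear factors *)

Section RepresentedIdeal.
Context {K : closedFieldType}.
Local Open Scope classical_set_scope.
Local Notation S := {mpoly K[2]}.
Variables (D : representation K) (U : S) (L : nat -> S).
Hypothesis UL : admissible D U L.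
Local Notation r := (rank D).
Local Notation b0 := (beta0 D).
Local Notation n := (Delta D r).
Local Notation C := (canonical_chain UL).
Local Notation h := (label_form D).

Lemma Delta_leq k : (k <= r)%N -> (Delta D k <= n)%N.
Proof. exact: Delta_homo. Qed.

Lemma PhiTail_prod k : (k <= r)%N -> PhiTail D k = \prod_(Delta D k <= s < n) h s.
Proof.
move=> lek; rewrite PhiTail_labels // (big_nth (0, 0, 0)%N) size_drop size_labels.
rewrite -[in RHS](add0n (Delta D k)) big_addn; apply: eq_bigr => s _.
by rewrite nth_drop addnC.
Qed.

Lemma linprod_block k : (k <= r)%N ->
  exists2 c : K, c != 0 & PhiTail D k = c *: linprod C (b0 + Delta D k).
Proof.
move=> lek; have le := Delta_leq lek; exists ((-1) ^+ (n - Delta D k)).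
  by rewrite expf_neq0 // oppr_eq0 oner_eq0.
rewrite PhiTail_prod // /linprod addnC big_addn /= addKn -mul_mpolyC.
rewrite rmorphXn rmorphN rmorph1 -prodr_const_nat -big_split /=.
apply: eq_big_nat => s /andP [_ lts].
by rewrite addnC superdiag_right // mulrN mulN1r opprK.
Qed.

Lemma minor_deg_block k : (k <= r)%N -> minor_deg C (b0 + Delta D k) = alpha D k.
Proof.
case: k => [|k] lek; first by rewrite /Delta big_geq // addn0 minor_deg_left // alpha0.
have d_gt0 : (0 < Delta D k.+1)%N by rewrite DeltaS addn_gt0 delta_gt0 ?orbT.
have le := Delta_leq lek; have lts : ((Delta D k.+1).-1 < n)%N by rewrite prednK.
have := minor_deg_right UL lts; rewrite -addnS prednK // => ->; congr (alpha D _).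
apply/eqP; rewrite eqn_leq (label_block_leq lek lts) prednK // leqnn /=.
rewrite ltnNge (label_block_leq (ltnW lek) lts) -leqNgt -ltnS prednK //.
by rewrite DeltaS -addn1 leq_add2l delta_gt0.
Qed.

Lemma beta_block k : (k <= r)%N -> (alpha D k - (n - Delta D k) = beta D k)%N.
Proof. by move=> lek; rewrite /alpha addnK. Qed.

(** Up to a scalar PhiTail k is linprod at the end of block k, where minors have
    degree alpha k; so a minor of block k is PhiTail k times a form of degree
    beta k, and conversely such products lie in the ideal of the minors by
    [linprod_mul_in_ideal]. *)
Lemma represented_idealE : represented_ideal D = minor_ideal C.
Proof.
apply/seteqP; split.
  apply: generated_min (minor_ideal_ideal C) _ => _ [k [g [lek hg ->]]].
  have [c _ ->] := linprod_block lek; have [_ _ JM] := minor_ideal_ideal C.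
  rewrite -mul_mpolyC -mulrA; apply: JM.
  have lej : (b0 + Delta D k <= len C)%N by rewrite leq_add2l Delta_leq.
  apply: linprod_mul_in_ideal hg => //; rewrite -beta_block // -minor_deg_block //.
  by rewrite /minor_deg /= subnDl addnK.
apply: generated_min (generated_ideal _) _ => _ /minorsP [j lej ->].
have [k [lek lej' Ed]] : exists k, [/\ (k <= r)%N, (j <= b0 + Delta D k)%N
    & minor_deg C j = alpha D k].
  case: (leqP j b0) => [lejb|ltbj].
    by exists 0%N; rewrite minor_deg_left // alpha0 (leq_trans lejb) ?leq_addr.
  have lts : (j - b0.+1 < n)%N by move: lej => /=; lia.
  have /and3P [/andP [_ lek] _ _] := labelP lts.
  exists (label D (j - b0.+1)).1.1; split=> //.
    have := label_block_leq lek lts; rewrite leqnn => /esym; lia.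
  by rewrite -(minor_deg_right UL lts) -addSn subnKC.
have leJ : (b0 + Delta D k <= len C)%N by rewrite leq_add2l Delta_leq.
have [q Eq] := linprod_dvd C lej'; have [c c0 Ec] := linprod_block lek.
apply: mem_generated; exists k, (c^-1 *: pihomog mdeg (beta D k) (diaprod C j * q)).
split=> //; first by apply/dhomogZ/pihomogP.
rewrite Ec -scalerAr -scalerAl scalerA mulVf // scale1r mulrC.
rewrite -{1}(pihomog_dE (minor_homog lej)) Ed /minor Eq mulrA.
rewrite (pihomogM_homog _ _ (linprod_homog leJ)) /= subnDl beta_block //.
by rewrite /alpha leq_addl.
Qed.

Lemma PhiTail_vanish k l : (k <= r)%N -> (PhiTail D k).@[root_pt l] = 0 <->
  exists s, [/\ (s < n)%N, (k < (label D s).1.1)%N & (h s).@[root_pt l] = 0].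
Proof.
move=> lek; rewrite PhiTail_prod // rmorph_prod /=; split=> [/eqP|[s [lts ltk z]]].
  rewrite prodf_seq_eq0 => /hasP [s]; rewrite mem_index_iota => /andP [les lts] /= /eqP z.
  by exists s; split=> //; rewrite ltnNge (label_block_leq lek lts) -leqNgt.
apply/eqP; rewrite prodf_seq_eq0; apply/hasP; exists s; rewrite /= ?z ?eqxx //.
by rewrite mem_index_iota lts andbT leqNgt -(label_block_leq lek lts) -ltnNge.
Qed.

Lemma label_of k i j : (1 <= k <= r)%N -> (1 <= i <= v_ D k)%N -> (1 <= j <= mu_ D k i)%N ->
  (index (k, i, j) (labels D) < n)%N /\ label D (index (k, i, j) (labels D)) = (k, i, j).
Proof.
move=> kr iv jm; have kij : (k, i, j) \in labels D.
  by rewrite [labels D]/(labels_of D (iota 1 r)) mem_labels_of mem_iota add1n ltnS kr iv.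
by rewrite -size_labels index_mem /label nth_index.
Qed.

Lemma Phi_vanish k l : (1 <= k <= r)%N -> (Phi D k).@[root_pt l] = 0 <->
  exists s, [/\ (s < n)%N, (label D s).1.1 = k & (h s).@[root_pt l] = 0].
Proof.
move=> kr; rewrite rmorph_prod /=; split=> [/eqP|[s [lts Ek z]]].
  rewrite prodf_seq_eq0 => /hasP [i]; rewrite mem_index_iota ltnS => iv /=.
  rewrite rmorphXn /= expf_eq0 => /andP [_ /eqP z].
  have m1 : (1 <= 1 <= mu_ D k i)%N by rewrite /= mu_gt0.
  have [lts E] := label_of kr iv m1.
  by exists (index (k, i, 1%N) (labels D)); rewrite /label_form E.
have /and3P [_ iv jm] := labelP lts; rewrite Ek in iv jm.
apply/eqP; rewrite prodf_seq_eq0; apply/hasP; exists (label D s).1.2.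
  by rewrite mem_index_iota ltnS.
by rewrite /= rmorphXn /= expf_eq0 mu_gt0 //= -Ek -[H_ _ _ _]/(h s) z.
Qed.

Lemma PhiTail_homog k : (k <= r)%N -> PhiTail D k \is (n - Delta D k).-homog.
Proof.
move=> lek; have [c _ ->] := linprod_block lek; apply: dhomogZ.
have leJ : (b0 + Delta D k <= len C)%N by rewrite leq_add2l Delta_leq.
by have := linprod_homog leJ; rewrite /= subnDl.
Qed.

Lemma Phi_homog k : (1 <= k <= r)%N -> exists d, Phi D k \is d.-homog.
Proof.
move=> kr; rewrite /Phi big_nat.
apply: (@big_ind _ (fun f : S => exists d, f \is d.-homog)) => [|f g [d hf] [e hg]|i iv].
- by exists 0%N; apply: dhomog1.
- by exists (d + e)%N; apply: dhomogM.
- by rewrite ltnS in iv; exists (1 * mu_ D k i)%N; apply: dhomogMn; case: (H_linear kr iv).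
Qed.

Lemma superdiag_vanish s l : (s < n)%N -> linear_form l ->
  (lin C (b0 + s)).@[root_pt l] = 0 <-> (h s).@[root_pt l] = 0.
Proof.
move=> lts ll; rewrite /= superdiag_right // mevalN.
by split=> [/eqP|->]; rewrite ?oppr0 // oppr_eq0 => /eqP.
Qed.

(** The entries L_i are followed by minors of the initial degree, so that only
    the factors of Phi are counted. *)
Lemma nb_factors_PhiAll : nb_linear_forms (fun l => divides l (PhiAll D))
  (nb_essential_above (minors C) (minor_deg C 0)).
Proof.
rewrite (nb_essential_above_minors (canonical_dia_next (UL := UL))).
apply: nb_linear_forms_last => l ll.
rewrite (divides_vanish (PhiTail_homog (leq0n r)) ll) PhiTail_vanish //.
rewrite minor_deg_left // -(alpha0 D); split=> [[s [lts _ z]]|[i [/= lti li ci il]]].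
  have ltj : (b0 + s < len C)%N by rewrite ltn_add2l.
  move/(superdiag_vanish lts ll): z => z.
  have [i [/andP [lei lti] li il _]] := last_root ll ltj z.
  have lts' : (i - b0 < n)%N by move: lti => /=; lia.
  exists i; split=> //; have -> : i = (b0 + (i - b0))%N by lia.
  rewrite minor_deg_right // alpha_lt //.
  by have /and3P [-> _ _] := labelP lts'.
have lei : (b0 <= i)%N.
  by rewrite leqNgt; apply/negP => ltib; move: ci; rewrite minor_deg_left // alpha0 ltnn.
have lts : (i - b0 < n)%N by lia.
exists (i - b0)%N; split=> //; first by have /and3P [/andP [-> _] _ _] := labelP lts.
by apply/(superdiag_vanish lts ll); rewrite subnKC.
Qed.

(** A linear factor of Phi k divides no later Phi m exactly when its last
    occurrence lies in block k. *)
Lemma nb_factors_block k : (1 <= k <= r)%N ->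
  nb_linear_forms (fun l => divides l (Phi D k) /\ ~ divides l (PhiTail D k))
    (nb_essential (minors C) (alpha D k)).
Proof.
move=> kr; have /andP [k1 ler] := kr.
rewrite (nb_essential_minors (canonical_dia_next (UL := UL))); last first.
  by rewrite minor_deg_left // -(alpha0 D) alpha_lt // k1.
apply: nb_linear_forms_last => l ll; have [d hd] := Phi_homog kr.
rewrite (divides_vanish hd ll) (divides_vanish (PhiTail_homog ler) ll).
rewrite Phi_vanish // PhiTail_vanish //; split=> [[[s [lts Ek z]] nz]|[i [/= lti li /eqP ci il]]].
  have ltj : (b0 + s < len C)%N by rewrite ltn_add2l.
  move/(superdiag_vanish lts ll): z => z.
  have [i [/andP [lei lti] li il _]] := last_root ll ltj z.
  have lts' : (i - b0 < n)%N by move: lti => /=; lia.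
  have Ei : i = (b0 + (i - b0))%N by lia.
  exists i; split=> //; rewrite Ei minor_deg_right //; apply/eqP; congr alpha.
  have les : (s <= i - b0)%N by lia.
  apply/eqP; rewrite eqn_leq -{2}Ek (label_block_homo les lts') andbT leqNgt; apply/negP => ltk.
  by case: nz; exists (i - b0)%N; split=> //; apply/(superdiag_vanish lts' ll); rewrite -Ei.
have lei : (b0 <= i)%N.
  rewrite leqNgt; apply/negP => ltib; move: ci; rewrite minor_deg_left // -(alpha0 D) => E.
  by have := @alpha_lt _ D 0 k; rewrite k1 ler E ltnn => /(_ isT).
have lts : (i - b0 < n)%N by lia.
have Ei : i = (b0 + (i - b0))%N by lia.
have /and3P [/andP [_ ler'] _ _] := labelP lts.
have Ek : (label D (i - b0)).1.1 = k.
  by move: ci; rewrite {1}Ei minor_deg_right // => /(alpha_inj ler' ler).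
have hz : (h (i - b0)).@[root_pt l] = 0 by apply/(superdiag_vanish lts ll); rewrite -Ei.
split; first by exists (i - b0)%N.
case=> s [lts' ltk z].
have lt_is : (i - b0 < s)%N.
  rewrite ltnNge; apply/negP => le.
  by have := label_block_homo le lts; rewrite Ek leqNgt ltk.
have ltj : (b0 + s < len C)%N by rewrite ltn_add2l.
have := last_occurrenceP _ _ li (b0 + s)%N; rewrite ltj andbT => /(_ _)/eqP; apply.
  by rewrite Ei ltn_add2l.
have ltiC : (i < len C)%N := lti.
have [c c0 Ec] := proportional_of_vanish ll (lin_linear ltiC) il.
have [hj _] := lin_linear ltj.
apply/(divides_vanish hj (lin_linear ltiC)); rewrite Ec; apply/(dividesZl _ _ c0).
by apply/(divides_vanish hj ll)/(superdiag_vanish lts' ll).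
Qed.

End RepresentedIdeal.

(** * Products of distinct linear factors *)

Section DistinctFactors.
Context {K : closedFieldType}.
Local Notation S := {mpoly K[2]}.
Variables (D : representation K) (U : S) (L : nat -> S).
Hypothesis UL : admissible D U L.
Local Notation b0 := (beta0 D).
Local Notation n := (Delta D (rank D)).
Local Notation C := (canonical_chain UL).
Local Notation h := (label_form D).

Lemma PhiAll_prod : PhiAll D = \prod_(0 <= s < n) h s.
Proof.
by rewrite /PhiAll PhiTail_prod //; have -> : Delta D 0 = 0%N by rewrite /Delta big_geq.
Qed.

Lemma proportional_not_indep (f g l : S) (c d : K) :
  c != 0 -> f = c *: l -> g = d *: l -> ~ lin_indep f g.
Proof.
move=> c0 -> -> /(_ d (- c)) [|_ /eqP]; last by rewrite oppr_eq0 (negPf c0).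
by rewrite scaleNr !scalerA mulrC subrr.
Qed.

(** If h s occurs again, dividing Phi by h s leaves a form still vanishing at its
    zero, so any factorization of Phi has two factors proportional to h s. *)
Lemma distinct_factorsE : product_of_distinct_linear_factors (PhiAll D) <->
  forall i, (i < len C)%N -> last_occurrence C i.
Proof.
split=> [[ls [lls ind] E] i /= lti|alllast].
  case: (ltnP i b0) => [/last_occurrence_left //|lei].
  have lts : (i - b0 < n)%N by lia.
  rewrite -(subnKC lei) last_occurrence_right //; apply/negP => /(repeatedP lts).
  set s := (i - b0)%N in lts * => -[s' /andP [lt lts'] Eh].
  have ll := label_linear lts; have [hl l0] := ll.
  have E2 : PhiAll D = h s * (h s' *
      \prod_(k < n | (k != Ordinal lts) && (k != Ordinal lts')) h k).
    rewrite PhiAll_prod big_mkord (bigD1 (Ordinal lts)) //= (bigD1 (Ordinal lts')) //=.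
    by rewrite -val_eqE /= gtn_eqF.
  have memls (k : 'I_(size ls)) : linear_form ls`_k by apply/lls/mem_nth.
  have Els : PhiAll D = \prod_(k < size ls) ls`_k by rewrite E (big_nth 0) big_mkord.
  have : (\prod_(k < size ls) ls`_k).@[root_pt (h s)] == 0.
    by rewrite -Els E2 mevalM meval_root_pt // mul0r.
  rewrite rmorph_prod /= prodf_seq_eq0 => /hasP [i0 _ /= /eqP z0].
  have [c c0 Ec] := proportional_of_vanish ll (memls i0) z0.
  have : (\prod_(k < size ls | k != i0) ls`_k).@[root_pt (h s)] == 0.
    move: E2; rewrite Els (bigD1 i0) //= Ec -scalerAl scalerAr.
    move/(mulfI l0)/(congr1 (meval (root_pt (h s)))).
    by rewrite mevalZ mevalM Eh meval_root_pt // mul0r => /eqP; rewrite mulf_eq0 (negPf c0).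
  rewrite rmorph_prod => /prodf_eq0 [i1 i10 /eqP z1].
  have [d d0 Ed] := proportional_of_vanish ll (memls i1) z1.
  move: i10; rewrite -val_eqE /= neq_ltn => /orP [] lt01.
    by apply: (proportional_not_indep d0 Ed Ec); apply: ind; rewrite lt01 /=.
  by apply: (proportional_not_indep c0 Ec Ed); apply: ind; rewrite lt01 /=.
exists [seq h s | s <- iota 0 n]; last by rewrite big_map PhiAll_prod /index_iota subn0.
split=> [l /mapP [s]|i j]; first by rewrite mem_iota => lts ->; apply: label_linear.
rewrite size_map size_iota => /andP [ltij ltj]; have lti := ltn_trans ltij ltj.
rewrite !(nth_map 0%N) ?size_iota // !nth_iota // !add0n.
case: (label_form_eq_or_indep lti ltj) => // Eh.
have /alllast : (b0 + i < len C)%N by rewrite ltn_add2l.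
rewrite last_occurrence_right // => /negP; case.
by apply/(repeatedP lti); exists j; rewrite ?ltij.
Qed.

End DistinctFactors.

Theorem corollary4p1 (K : closedFieldType) (I : set {mpoly K[2]})
  (D : representation K) (U : {mpoly K[2]}) (L : nat -> {mpoly K[2]})
  (a : nat) (I_F2 : in_F2 I) (I_rep : I = represented_ideal D)
  (UL : admissible D U L) (a_alpha : is_alpha I a) :
  [/\ (* (i) *)
      (forall j, (j <= beta0 D)%N ->
         essential (canonical_basis D U L) (F0 D U L j)) /\
      (forall k i j, (1 <= k <= rank D)%N -> (1 <= i <= v_ D k)%N ->
         (1 <= j <= mu_ D k i)%N ->
         (essential (canonical_basis D U L) (Fk D U L k i j) <->
          j = mu_ D k i /\ ~ divides (H_ D k i) (Fk D U L k i j))),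
      (* (ii) *)
      e_maximal I (canonical_basis D U L) /\
      nb_linear_forms (fun l => divides l (PhiAll D))
        (nb_essential_above (canonical_basis D U L) a),
      (* (iii) *)
      forall B, e_maximal I B -> forall k, (1 <= k <= rank D)%N ->
        nb_linear_forms
          (fun l => divides l (Phi D k) /\ ~ divides l (PhiTail D k))
          (nb_essential B (alpha D k))
    & (* (iv) *)
      (exists2 B, standard_basis I B & forall f, f \in B -> essential B f) <->
      product_of_distinct_linear_factors (PhiAll D)].
Proof.
set C := canonical_chain UL.
have EI : I = minor_ideal C by rewrite I_rep; apply: represented_idealE.
rewrite /F0 /Fk (canonical_basis_minors UL) {I_rep I_F2}.
move: a_alpha; rewrite {I}EI => a_alpha.
have nth_minors j : (j <= len C)%N -> (minors C)`_j = minor C j.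
  by move=> lej; rewrite (nth_map 0%N) ?size_iota // nth_iota.
have dn := canonical_dia_next (UL := UL); have df := canonical_dia_first UL.
have low := canonical_low_last (UL := UL).
split.
- split=> [j lej|k i j kr iv jm].
    have lejN : (j <= len C)%N by rewrite (leq_trans lej) ?leq_addr.
    by rewrite nth_minors //; apply: essential_low => //; rewrite !minor_deg_left.
  have [lts Els] := label_of kr iv jm; set s := index _ _ in lts Els *.
  have ltN : (beta0 D + s < len C)%N by rewrite ltn_add2l.
  rewrite addSn nth_minors // essential_minorS //.
  have lH := H_linear kr iv.
  rewrite (divides_vanish (minor_homog ltN) lH).
  have vanE : (minor C (beta0 D + s).+1).@[root_pt (H_ D k i)] = 0 <->
      (minor C (beta0 D + s).+1).@[root_pt (lin C (beta0 D + s))] = 0.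
    rewrite -(divides_vanish (minor_homog ltN) lH).
    rewrite -(divides_vanish (minor_homog ltN) (lin_linear ltN)).
    rewrite /= superdiag_right // /label_form Els /= -scaleN1r dividesZl //.
    by rewrite oppr_eq0 oner_eq0.
  split=> [ls|[_ nz]]; last first.
    by apply/negPn/negP => /(minor_not_last_vanishing ltN) /vanE.
  split; last by move/vanE; apply/eqP; apply: minor_last_nonvanishing.
  apply/eqP; rewrite eqn_leq; have /andP [j1 ->] := jm; rewrite /= leqNgt; apply/negP => ltj.
  move: ls; rewrite last_occurrence_right // => /negP; apply; apply/(repeatedP lts).
  have jm' : (1 <= mu_ D k i <= mu_ D k i)%N by rewrite leqnn andbT (leq_trans j1 (ltnW ltj)).
  have [lts' Els'] := label_of kr iv jm'.
  exists (index (k, i, mu_ D k i) (labels D)); last by rewrite /label_form Els Els'.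
  rewrite lts' andbT /s.
  apply: (@labels_index_lt _ (fun p => mu_ D p.1 p.2) (k, i)); rewrite ?j1 //.
  apply/allpairsPdep; exists k, i; rewrite !mem_iota !add1n !ltnS.
  by split.
- split; first exact: minors_e_maximal.
  by rewrite (alpha_minors df a_alpha); apply: nb_factors_PhiAll.
- move=> B maxB k kr; rewrite (e_maximal_nb dn df low _ maxB).
  exact: nb_factors_block.
- rewrite (distinct_factorsE UL); split=> [[B sB essB]|alllast].
    exact: (last_of_all_essential dn low sB essB).
  exists (minors C); first exact: minors_standard_basis.
  move=> _ /minorsP [[|j] lej ->]; first exact: essential_minor0.
  by apply/essential_minorS => //; apply: alllast.
Qed.
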